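(* Let $m$ be a positive integer and let $G$ be a finite group. Then one of the following holds: (1) $G$ has an $m$-DRR; (2) $m=1$ and $G$ is isomorphic to $Q_8$, $\mathbb{Z}_2^2$, $\mathbb{Z}_2^3$, $\mathbb{Z}_2^4$ or $\mathbb{Z}_3^2$; (3) $m=2$ and $G$ is isomorphic to $\mathbb{Z}_1$ or $\mathbb{Z}_2$; (4) $3\le m\le 5$ and $G$ is isomorphic to $\mathbb{Z}_1$.
   Context: All groups and digraphs are finite. A digraph is a pair $(V,A)$ with $A\subseteq V\times V$, with no loops; it is regular if there is an integer $d$ such that every vertex has in-valency and out-valency both equal to $d$. An automorphism is a permutation of $V$ preserving $A$. A permutation group is semiregular if every point stabilizer is trivial. For a positive integer $m$, an $m$-Cayley digraph over $G$ is a digraph having a semiregular group of automorphisms isomorphic to $G$ with exactly $m$ orbits on the vertex set. $G$ admits an $m$-DRR ($m$-digraphical regular representation) if there exists a regular $m$-Cayley digraph $\Gamma$ over $G$ with $\mathrm{Aut}(\Gamma)\cong G$. $Q_8$ is the quaternion group of order $8$ and $\mathbb{Z}_n$ the cyclic group of order $n$. *)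

(* Defs.v *)
From mathcomp Require Import all_boot all_fingroup all_algebra all_solvable.
Set Implicit Arguments. Unset Strict Implicit. Unset Printing Implicit Defensive.
Local Open Scope group_scope.

(* A digraph with vertex set V (a finite type) is given by its arc relation
   A : rel V; it has no loops. *)
Definition loopless (V : finType) (A : rel V) := forall v, ~~ A v v.

Definition regular_digraph (V : finType) (A : rel V) :=
  exists d : nat, forall v : V,
    #|[set w | A v w]| = d /\ #|[set w | A w v]| = d.

Definition is_aut (V : finType) (A : rel V) (s : {perm V}) :=
  [forall x, forall y, A (s x) (s y) == A x y].

Definition Aut (V : finType) (A : rel V) : {set {perm V}} :=
  [set s | is_aut A s].

Definition semiregular (V : finType) (H : {set {perm V}}) :=
  forall (h : {perm V}) (v : V), h \in H -> h v = v -> h = 1.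

Definition m_Cayley (gT : finGroupType) (G : {group gT}) (m : nat)
    (V : finType) (A : rel V) :=
  exists H : {group {perm V}},
    [/\ H \subset Aut A, semiregular H, H \isog G
      & #|orbit 'P H @: [set: V]| = m].

Definition has_mDRR (gT : finGroupType) (G : {group gT}) (m : nat) :=
  exists (V : finType) (A : rel V),
    [/\ loopless A, regular_digraph A, m_Cayley G m A & Aut A \isog G].

(* Main.v *)
Require Import Defs.
From mathcomp Require Import all_boot all_fingroup all_algebra all_solvable.
From mathcomp Require Import mxabelem zify.
Local Open Scope group_scope.
Set Implicit Arguments. Unset Strict Implicit. Unset Printing Implicit Defensive.

(* Call a representation of a subgroup H on H x {0, ..., m-1} dense if its valency
   exceeds half the number of vertices. Given x outside H, adding to a dense
   representation the arcs (g, i) -> (gx, i) yields a representation of <H, x>: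
   the old arcs are those u -> v for which some w satisfies u -> w -> v, so every
   automorphism respects the cosets of H, on which it is rigid. Up to complements,
   the new representation is again dense, hence it suffices to exhibit a dense
   representation of some subgroup of G.

   For m > 1, any two nontrivial elements generate a subgroup with a representation
   of valency 2 in which the layers form a path; it has a dense complement unless
   the subgroup is very small. For m = 1, small sets such as {a, b}, {a, b, ab} or
   {a, a^2, b} work as soon as the digraph they induce on the out-neighbours of 1
   is asymmetric. A group none of whose subgroups is dealt with in this way is
   cyclic, Q_8, S_3 or an elementary abelian 2- or 3-group. The ranks at least 5 and
   3, respectively, are handled by explicit sets found by a computer search. *)

(** * Layered Cayley digraphs and extension to larger groups *)

Lemma meet_of_cards (T : finType) (A B D : {set T}) :
  A \subset D -> B \subset D -> (#|D| < #|A| + #|B|)%N ->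
  exists2 x, x \in A & x \in B.
Proof.
move=> sAD sBD ltD.
suff /set0Pn[x /setIP[]] : A :&: B != set0 by exists x.
apply/eqP=> AB0; move: ltD; rewrite -cardsUI AB0 cards0 addn0 ltnNge.
by rewrite subset_leq_card // subUset sAD.
Qed.

Section Layers.

Variables (gT : finGroupType) (m : nat).
Implicit Types (G H : {group gT}) (S : 'I_m -> 'I_m -> {set gT}).
Implicit Types (u v w : gT * 'I_m) (d : nat).

(* [S i j] is the set of voltages of the arcs from layer [i] to layer [j]. *)
Definition larc S : rel (gT * 'I_m) :=
  fun u v => u.1^-1 * v.1 \in S u.2 v.2.

Definition layers G : {set gT * 'I_m} := setX G [set: 'I_m].

(** [f] is a map on the whole type constrained only over [G], so that a subgroup and its overgroups
    share one vertex type and maps can be translated between cosets. *)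
Definition layer_aut G S (f : gT * 'I_m -> gT * 'I_m) :=
  [/\ {in layers G, forall u, f u \in layers G},
      {in layers G &, injective f}
    & {in layers G &, forall u v, larc S (f u) (f v) = larc S u v}].

(** Left translations always preserve [larc S]; rigidity says that over [G] there are no other
    automorphisms. *)
Definition rigid G S :=
  forall f, layer_aut G S f ->
  exists2 g, g \in G & {in layers G, forall u, f u = (g * u.1, u.2)}.

Record mrep G S d : Prop := MRep {
  mrep_sub : forall i j, S i j \subset G;
  mrep_irr : forall i, 1 \notin S i i;
  mrep_out : forall i, (\sum_j #|S i j|)%N = d;
  mrep_in : forall i, (\sum_j #|S j i|)%N = d;
  mrep_rigid : rigid G S
}.

(* The second inequality leaves room for the complement to be dense again after a
   generator has been added. *)
Definition good G :=
  exists S, exists2 d, mrep G S d & (#|G| * m < 2 * d)%N && (d + 2 < #|G| * m)%N.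

Lemma in_layers G u : (u \in layers G) = (u.1 \in G).
Proof. by case: u => x i; rewrite in_setX inE andbT. Qed.

Lemma card_layers G : #|layers G| = (#|G| * m)%N.
Proof. by rewrite cardsX cardsT card_ord. Qed.

Lemma card_out S u : #|[set v | larc S u v]| = (\sum_j #|S u.2 j|)%N.
Proof.
rewrite -sum1_card big_mkcond /=.
rewrite (eq_bigr (fun v => (u.1^-1 * v.1 \in S u.2 v.2 : nat))); last first.
  by move=> v _; rewrite inE /larc; case: ifP.
rewrite -(pair_bigA _ (fun x j => (u.1^-1 * x \in S u.2 j : nat))) /= exchange_big.
apply: eq_bigr => j _; rewrite (reindex_inj (mulgI u.1)) /= -sum1_card [RHS]big_mkcond.
by apply: eq_bigr => x _; rewrite mulKg; case: ifP.
Qed.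

Lemma card_in S u : #|[set v | larc S v u]| = (\sum_j #|S j u.2|)%N.
Proof.
rewrite -sum1_card big_mkcond /=.
rewrite (eq_bigr (fun v => (v.1^-1 * u.1 \in S v.2 u.2 : nat))); last first.
  by move=> v _; rewrite inE /larc; case: ifP.
rewrite -(pair_bigA _ (fun x j => (x^-1 * u.1 \in S j u.2 : nat))) /= exchange_big.
apply: eq_bigr => j _; rewrite (reindex_inj (inj_comp (mulgI u.1) invg_inj)) /=.
rewrite -sum1_card [RHS]big_mkcond.
by apply: eq_bigr => x _; rewrite invMg invgK mulgKV; case: ifP.
Qed.

Lemma larc_in G S u v : (forall i j, S i j \subset G) ->
  larc S u v -> (u.1 \in G) = (v.1 \in G).
Proof.
move=> sSG /(subsetP (sSG _ _)) Guv; apply/idP/idP => [Gu | Gv].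
  by rewrite -(groupMl v.1 (groupVr Gu)).
by rewrite (groupMr _ Gv) groupV in Guv.
Qed.

Lemma larc_mul S g u v : larc S (g * u.1, u.2) (g * v.1, v.2) = larc S u v.
Proof. by rewrite /larc /= invMg -!mulgA mulKg. Qed.

Definition lcompl G S : 'I_m -> 'I_m -> {set gT} :=
  fun i j => G :\: (if i == j then 1 |: S i j else S i j).

Lemma larc_compl G S u v : u \in layers G -> v \in layers G ->
  (forall i, 1 \notin S i i) ->
  larc (lcompl G S) u v = (u != v) && ~~ larc S u v.
Proof.
rewrite !in_layers /larc /lcompl; case: u v => [x i] [y j] /= Gx Gy irr.
rewrite inE groupMl ?groupV // Gy andbT xpair_eqE.
case: eqP => [<-|_] /=; last by rewrite andbF.
by rewrite !inE negb_or andbT -eq_mulVg1.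
Qed.

Lemma rigid_compl G S : (forall i, 1 \notin S i i) -> rigid G S -> rigid G (lcompl G S).
Proof.
move=> irr rigS f [fG fI fA]; apply: rigS; split=> // u v Gu Gv.
have := fA _ _ Gu Gv; rewrite !larc_compl ?fG //.
rewrite (inj_in_eq fI) //; case: eqP => [<- _ | _ /= /(congr1 negb)]; last by rewrite !negbK.
by rewrite /larc !mulVg !(negPf (irr _)).
Qed.

Lemma card_lcompl G S i j : S i j \subset G -> (i = j -> 1 \notin S i j) ->
  #|lcompl G S i j| = (#|G| - #|S i j| - (i == j))%N.
Proof.
move=> sSG irr; rewrite /lcompl cardsD.
case: eqP => [/irr irrij | _]; last by rewrite (setIidPr sSG) subn0.
by rewrite (setIidPr _) ?subUset ?sub1set ?group1 // cardsU1 irrij addnC subnDA.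
Qed.

Lemma sum_eq_ord (i : 'I_m) : (\sum_(j < m) (i == j) = 1)%N.
Proof. by rewrite (bigD1 i) //= eqxx big1 // => j; rewrite eq_sym => /negPf->. Qed.

Lemma sum_sub_le (A B C : 'I_m -> nat) : (forall j, B j + C j <= A j)%N ->
  (\sum_j (A j - B j - C j) = \sum_j A j - \sum_j B j - \sum_j C j)%N.
Proof.
move=> le; have -> : (\sum_j A j = \sum_j (A j - B j - C j) + \sum_j B j + \sum_j C j)%N.
  by rewrite -!big_split; apply: eq_bigr => j _ /=; move: (le j); lia.
by lia.
Qed.

Lemma mrep_compl G S d : mrep G S d -> mrep G (lcompl G S) (#|G| * m - d - 1).
Proof.
case=> sSG irr oS iS rS.
have le i j : (#|S i j| + (i == j) <= #|G|)%N.
  case: eqP => [<-|_]; last by rewrite addn0 subset_leq_card.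
  have cU : #|1 |: S i i| = #|S i i|.+1 by rewrite cardsU1 irr.
  by rewrite addn1 -cU subset_leq_card // subUset sub1set group1 sSG.
have sG : (\sum_(j < m) #|G| = #|G| * m)%N by rewrite sum_nat_const card_ord mulnC.
have cS i j : #|lcompl G S i j| = (#|G| - #|S i j| - (i == j))%N.
  by rewrite card_lcompl // => <-; apply: irr.
split=> [i j|i|i|i|].
- exact: subsetDl.
- by rewrite /lcompl eqxx !inE eqxx.
- rewrite (eq_bigr _ (fun j _ => cS i j)) sum_sub_le ?sG ?oS ?sum_eq_ord //.
- rewrite (eq_bigr _ (fun j _ => cS j i)) sum_sub_le ?sG ?iS //.
  by rewrite -[X in (_ - X)%N](eq_bigr _ (fun j _ => congr1 nat_of_bool (eq_sym i j))) sum_eq_ord.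
exact: rigid_compl.
Qed.

(** The complement has valency $|G|m-d-1$: the upper bound on [d] makes it dense, and [1 < d]
    provides the second inequality of [good]. *)
Lemma small_good G S d :
  mrep G S d -> (1 < d)%N -> (2 * d + 2 < #|G| * m)%N -> good G.
Proof.
by move=> /mrep_compl rS d1 dG; exists (lcompl G S), (#|G| * m - d - 1)%N => //; lia.
Qed.

Definition ladd S x : 'I_m -> 'I_m -> {set gT} :=
  fun i j => if i == j then x |: S i j else S i j.

Lemma larc_add H S x u v : (forall i j, S i j \subset H) -> x \notin H ->
  larc (ladd S x) u v = larc S u v || (v == (u.1 * x, u.2)).
Proof.
move=> sSH Hx; rewrite /larc /ladd; case: u v => [y i] [z j] /=.
rewrite xpair_eqE; case: (eqVneq i j) => [<-|ne] /=.
  by rewrite in_setU1 ?eqxx andbT orbC (can2_eq (mulKVg y) (mulKg y)).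
  by rewrite andbF orbF.
Qed.

(** The elements whose right multiplication commutes with [f] are closed under products, hence form
    a subgroup of a finite group. Rigidity proofs thus only have to look at generators. *)
Lemma equivariant_gen (A : {set gT}) (f : gT * 'I_m -> gT * 'I_m) :
  (forall a u, a \in A -> u.1 \in <<A>> -> f (u.1 * a, u.2) = ((f u).1 * a, (f u).2)) ->
  forall y u, y \in <<A>> -> u.1 \in <<A>> -> f (u.1 * y, u.2) = ((f u).1 * y, (f u).2).
Proof.
move=> fA; pose P y := [forall u, (u.1 \in <<A>>) ==>
  (f (u.1 * y, u.2) == ((f u).1 * y, (f u).2))].
pose Y := [set y in <<A>> | P y].
have gY : group_set Y.
  apply/group_setP; split=> [|y z].
    rewrite inE group1; apply/forallP=> -[g i]; apply/implyP=> _ /=.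
    by rewrite !mulg1; case: (f _).
  rewrite !inE => /andP[Gy /forallP Py] /andP[Gz /forallP Pz].
  rewrite groupM //; apply/forallP=> -[g i]; apply/implyP=> /= Gg.
  have /eqP /= ez := implyP (Pz (g * y, i)) (groupM Gg Gy).
  have /eqP /= ey := implyP (Py (g, i)) Gg.
  by rewrite mulgA ez ey mulgA.
have sAY : <<A>> \subset Group gY.
  rewrite gen_subG; apply/subsetP=> a Aa; rewrite inE mem_gen //.
  by apply/forallP=> u; apply/implyP=> Au; rewrite fA.
move=> y u /(subsetP sAY); rewrite inE => /andP[_ /forallP/(_ u)/implyP Py].
by move/Py/eqP.
Qed.

(* The density of [S] on [H] makes the arcs [u -> u x] the only ones whose ends
   are not joined by a path of length two, so automorphisms preserve them. *)
Lemma rigid_add H S d x : mrep H S d -> (#|H| * m < 2 * d)%N -> x \notin H ->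
  rigid <<x |: H>> (ladd S x).
Proof.
case=> sSH irr oS iS rS dense Hx f [fG fI fA].
set K := <<x |: H>>%G in fG fI fA *.
have sHK : H \subset K by rewrite sub_gen ?subsetUr.
have Kx : x \in K by rewrite mem_gen ?setU11.
have larcx := larc_add _ _ sSH Hx.
have outH u : u \in layers H -> [set v | larc S u v] \subset layers H.
  move=> Hu; apply/subsetP=> v; rewrite inE in_layers => /(larc_in sSH) <-.
  by rewrite -in_layers.
have inH u : u \in layers H -> [set v | larc S v u] \subset layers H.
  move=> Hu; apply/subsetP=> v; rewrite inE in_layers => /(larc_in sSH) ->.
  by rewrite -in_layers.
(* Translated to [H], the out-neighbours of [u] and the in-neighbours of [v] each fill more than
   half of the [#|H| * m] vertices, so they meet. The claim [com] uses out-neighbours twice. *)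
have mid u v : u.1^-1 * v.1 \in H -> exists2 w, larc S u w & larc S w v.
  move=> Huv.
  have [||| w] := @meet_of_cards _ [set w | larc S (1, u.2) w]
    [set w | larc S w (u.1^-1 * v.1, v.2)] (layers H).
  - by apply: outH; rewrite in_layers ?group1.
  - by apply: inH; rewrite in_layers ?group1.
  - by rewrite card_layers card_out card_in oS iS addnn -mul2n.
  rewrite !inE => uw wv; exists (u.1 * w.1, w.2).
    by rewrite -(larc_mul _ u.1^-1) /= mulVg mulKg; case: (w) uw.
  by rewrite -(larc_mul _ u.1^-1) /= mulKg; case: (w) wv.
have com u v : u.1^-1 * v.1 \in H -> exists2 w, larc S u w & larc S v w.
  move=> Huv.
  have [||| w] := @meet_of_cards _ [set w | larc S (1, u.2) w]
    [set w | larc S (u.1^-1 * v.1, v.2) w] (layers H).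
  - by apply: outH; rewrite in_layers ?group1.
  - by apply: outH; rewrite in_layers ?group1.
  - by rewrite card_layers card_out card_out !oS addnn -mul2n.
  rewrite !inE => uw wv; exists (u.1 * w.1, w.2).
    by rewrite -(larc_mul _ u.1^-1) /= mulVg mulKg; case: (w) uw.
  by rewrite -(larc_mul _ u.1^-1) /= mulKg; case: (w) wv.
have xarc u v : larc (ladd S x) u v ->
    (v == (u.1 * x, u.2)) = ~~ larc S u v.
  rewrite larcx; case: (boolP (larc S u v)) => /= [|_ ->//].
  move/(subsetP (sSH _ _)) => Huv _; apply: contraNF Hx => /eqP Dv.
  by move: Huv; rewrite Dv /= mulKg.
(* Two old arcs would put [x] in [H]; an old arc combined with a new one would have voltage 1; two
   new arcs would give [x = 1]. *)
have no2 u v w : v = (u.1 * x, u.2) ->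
    larc (ladd S x) u w -> larc (ladd S x) w v -> False.
  move=> ->; rewrite !larcx; case/orP=> [uw | /eqP->].
    case/orP=> [wv | /eqP[/mulIg e1 e2]].
      have := groupM (subsetP (sSH _ _) _ uw) (subsetP (sSH _ _) _ wv).
      by rewrite mulgA mulgK mulKg (negPf Hx).
    by move: uw; rewrite /larc e1 mulVg e2; apply/negP/irr.
  case/orP => [|/eqP[e1]]; first by rewrite /larc mulVg; apply/negP/irr.
  case/negP: Hx.
  by rewrite (canRL (mulKg _) (esym e1)) /= mulVg group1.
have sSH' u v : larc S u v -> u.1^-1 * v.1 \in H by apply/subsetP.
have Klarc u v : larc S u v -> u \in layers K -> v \in layers K.
  move=> uv; rewrite !in_layers => Ku; rewrite -(larc_in _ uv) // => i j.
  exact: subset_trans (sSH i j) sHK.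
have Kxu u : u \in layers K -> (u.1 * x, u.2) \in layers K.
  by rewrite !in_layers => Ku; apply: groupM.
have fK : f @: layers K = layers K.
  apply/eqP; rewrite eqEcard card_in_imset // leqnn andbT.
  by apply/subsetP=> _ /imsetP[u Ku ->]; apply: fG.
have fx u : u \in layers K -> f (u.1 * x, u.2) = ((f u).1 * x, (f u).2).
  move=> Ku; apply/eqP.
  have uv : larc (ladd S x) u (u.1 * x, u.2) by rewrite larcx eqxx orbT.
  have fuv : larc (ladd S x) (f u) (f (u.1 * x, u.2)) by rewrite fA ?Kxu.
  (* If a new arc went to an old one, the image would be bypassed through some [w]. As [f] is onto,
     [w] has a preimage, which bypasses the new arc and contradicts [no2]. *)
  rewrite xarc //; apply/negP=> /sSH'/mid[w uw wv].
  have := Klarc _ _ uw (fG _ Ku); rewrite -fK => /imsetP[w' Kw' Dw].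
  apply: (no2 u _ w' (erefl _)); rewrite -fA ?Kxu // -Dw larcx ?uw ?wv //.
have larcE u v : larc S u v = larc (ladd S x) u v && (v != (u.1 * x, u.2)).
  case: (boolP (larc (ladd S x) u v)) => [/xarc-> | ]; first by rewrite negbK.
  by rewrite larcx => /norP[/negPf].
have flarc : {in layers K &, forall u v, larc S (f u) (f v) = larc S u v}.
  move=> u v Ku Kv; rewrite !larcE fA //; congr (_ && ~~ _).
  by rewrite -fx // (inj_in_eq fI) ?Kxu.
(* Vertices over one coset of [H] have a common out-neighbour along old arcs; so do their images,
   which therefore lie over one coset too. *)
have fcoset u v : u \in layers K -> u.1^-1 * v.1 \in H ->
    (f u).1^-1 * (f v).1 \in H.
  move=> Ku Huv; have [w uw vw] := com _ _ Huv.
  have Kv : v \in layers K.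
    by move: Ku; rewrite !in_layers => Ku; rewrite -(mulKVg u.1 v.1) groupM // (subsetP sHK).
  have Kw := Klarc _ _ uw Ku.
  rewrite -(flarc _ _ Ku Kw) in uw; rewrite -(flarc _ _ Kv Kw) in vw.
  have -> : (f u).1^-1 * (f v).1 = (f u).1^-1 * (f w).1 * ((f v).1^-1 * (f w).1)^-1.
    by rewrite invMg invgK mulgA mulgK.
  by rewrite groupM ?groupV ?sSH'.
case: (posnP m) => [m0 | m_gt0].
  by exists 1 => // -[g i]; have := leq_ltn_trans (leq0n i) (ltn_ord i); lia.
pose i0 := Ordinal m_gt0.
have fH g : g \in K -> exists2 k, k \in K &
    forall y i, y \in H -> f (g * y, i) = (k * y, i).
  move=> Kg; have Kgi i : (g, i) \in layers K by rewrite in_layers.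
  set k := (f (g, i0)).1; have Kk : k \in K by rewrite -in_layers fG.
  have KHg u : u \in layers H -> (g * u.1, u.2) \in layers K.
    by rewrite !in_layers => /(subsetP sHK) Hu; apply: groupM.
  (* Left translations carry [f] from the coset of [g] back to [H], where rigidity of [S]
     applies. *)
  pose f' u := (k^-1 * (f (g * u.1, u.2)).1, (f (g * u.1, u.2)).2).
  have [|h Hh Dh] := rS f'; first split=> [u Hu|u v Hu Hv|u v Hu Hv].
  - rewrite in_layers /=; apply: (fcoset (g, i0)) => //=.
    by rewrite mulKg -in_layers.
  - case=> /mulgI e1 e2; have := fI _ _ (KHg _ Hu) (KHg _ Hv).
    rewrite [f (g * u.1, _)]surjective_pairing e1 e2 -surjective_pairing.
    case/(_ (erefl _)) => /mulgI {}e1 {}e2.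
    by rewrite [u]surjective_pairing e1 e2 -surjective_pairing.
  - by rewrite larc_mul flarc ?KHg // larc_mul.
  exists (k * h); first by rewrite groupM // (subsetP sHK).
  move=> y i Hy; have := Dh (y, i); rewrite in_layers => /(_ Hy) [e1 e2].
  by rewrite [LHS]surjective_pairing e2 -[_.1](mulKVg k) e1 mulgA.
have fE y u : y \in K -> u.1 \in K -> f (u.1 * y, u.2) = ((f u).1 * y, (f u).2).
  apply: equivariant_gen => a [z j]; rewrite in_setU1 => /predU1P[-> | Ha] /= Kz.
    by rewrite (fx (z, j)) ?in_layers.
  have [l _ Dl] := fH z Kz; have := Dl 1 j (group1 _); rewrite !mulg1 => ->.
  by rewrite Dl.
have [k Kk Dk] := fH 1 (group1 _); exists k => // -[g i]; rewrite in_layers => /= Kg.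
have := Dk 1 i (group1 _); rewrite !mulg1 => D1.
by rewrite -{1}[g]mul1g (fE g (1, i)) //= D1.
Qed.

Lemma mrep_add H S d x : mrep H S d -> (#|H| * m < 2 * d)%N -> x \notin H ->
  mrep <<x |: H>> (ladd S x) d.+1.
Proof.
move=> rS dense Hx; have [sSH irr oS iS _] := rS.
have sHK : H \subset <<x |: H>> by rewrite sub_gen ?subsetUr.
have cS i j : #|ladd S x i j| = (#|S i j| + (i == j))%N.
  rewrite /ladd; case: eqP => _; last by rewrite addn0.
  by rewrite cardsU1 (contra (subsetP (sSH i j) x) Hx) addnC.
split=> [i j|i|i|i|].
- have sSK := subset_trans (sSH i j) sHK.
  by rewrite /ladd; case: ifP => // _; rewrite subUset sub1set mem_gen ?setU11.
- rewrite /ladd eqxx !inE negb_or irr andbT eq_sym.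
  by apply: contraNneq Hx => ->; rewrite group1.
- by rewrite (eq_bigr _ (fun j _ => cS i j)) big_split /= oS sum_eq_ord addn1.
- rewrite (eq_bigr _ (fun j _ => cS j i)) big_split /= iS.
  rewrite -[X in (_ + X)%N](eq_bigr _ (fun j _ => congr1 nat_of_bool (eq_sym i j))).
  by rewrite sum_eq_ord addn1.
exact: rigid_add rS dense Hx.
Qed.

(** The index of [H] is at least two, so $2(d+1)+2 = 2(d+2) < 2|H|m$ is less than the number of new
    vertices, and the complement is dense again. *)
Lemma good_add H x : good H -> x \notin H -> good <<x |: H>>%G.
Proof.
case=> S [d rS /andP[dense sparse]] Hx.
apply: (small_good (mrep_add rS dense Hx)); first by case: d rS dense sparse => [|d] _; lia.
have sHK : H \subset <<x |: H>>%G by rewrite sub_gen ?subsetUr.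
have := indexg_gt1 <<x |: H>>%G H.
have -> : ~~ (<<x |: H>>%G \subset H).
  by apply: contra Hx => /subsetP; apply; rewrite mem_gen ?setU11.
rewrite -(Lagrange sHK); nia.
Qed.

Lemma good_supergroup H G : good H -> H \subset G -> good G.
Proof.
move=> gH sHG; have [n le_n] := ubnP (#|G| - #|H|); elim: n => // n IHn in H gH sHG le_n *.
have [sGH | /subsetPn[x Gx Hx]] := boolP (G \subset H).
  by rewrite -(_ : H = G) //; apply/val_inj/eqP; rewrite eqEsubset sHG.
have sKG : <<x |: H>>%G \subset G by rewrite gen_subG subUset sub1set Gx.
apply: (IHn _ (good_add gH Hx) sKG).
have : (#|H| < #|<<x |: H>>%G|)%N.
  apply: proper_card; rewrite properE sub_gen ?subsetUr //=.
  by apply: contra Hx => /subsetP; apply; rewrite mem_gen ?setU11.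
have := subset_leq_card sKG; lia.
Qed.

End Layers.

(** * From rigid connection sets to digraphs with prescribed automorphism group *)

Section Realization.

Variables (gT : finGroupType) (G : {group gT}) (m : nat).
Variables (S : 'I_m -> 'I_m -> {set gT}) (d : nat).
Hypotheses (m_gt0 : (0 < m)%N) (rS : mrep G S d).

Local Notation V := (subg_of G * 'I_m)%type.

(** A digraph lives on a whole finite type, so its vertices are taken over [subg_of G]; [lemb]
    identifies them with [layers m G]. *)
Definition lemb (v : V) : gT * 'I_m := (sgval v.1, v.2).
Definition ldigraph : rel V := fun v w => larc S (lemb v) (lemb w).

(* Inverted, since products of permutations compose left to right. *)
Definition lshift (g : subg_of G) (v : V) : V := (g^-1 * v.1, v.2).

Lemma lshift_inj g : injective (lshift g).
Proof.
by move=> [x i] [y j] e; have /mulgI/=-> := congr1 fst e; have /=-> := congr1 snd e.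
Qed.

Definition lperm g : {perm V} := perm (@lshift_inj g).

Lemma lpermM : {in [set: subg_of G] &, {morph lperm : g h / g * h}}.
Proof.
by move=> g h _ _; apply/permP=> -[x i]; rewrite permM !permE /lshift /= invMg mulgA.
Qed.

Definition lperm_morphism := Morphism lpermM.

Lemma injm_lperm : 'injm lperm_morphism.
Proof.
apply/injmP=> g h _ _ /permP/(_ (1, Ordinal m_gt0)); rewrite !permE.
by move/(congr1 fst)/mulIg/invg_inj.
Qed.

Lemma lemb_inj : injective lemb.
Proof. by move=> [x i] [y j] [/subg_inj-> ->]. Qed.

Lemma lemb_in v : lemb v \in layers m G.
Proof. by rewrite in_layers /= subgP. Qed.

Lemma lembK u : u \in layers m G -> lemb (subg G u.1, u.2) = u.
Proof. by rewrite in_layers; case: u => x i /= Gx; rewrite /lemb /= subgK. Qed.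

Lemma Aut_ldigraph : Defs.Aut ldigraph = lperm_morphism @* [set: subg_of G].
Proof.
apply/setP=> s; rewrite !inE; apply/idP/morphimP => [/forallP sA | [g _ _ ->]]; last first.
  apply/forallP=> v; apply/forallP=> w; rewrite /= !permE /ldigraph /lemb /=.
  by rewrite (larc_mul S (sgval g)^-1 (lemb v) (lemb w)).
have {}sA v w : ldigraph (s v) (s w) = ldigraph v w by apply/eqP/(forallP (sA v)).
(* [subg G] takes a default value outside [G], where nothing is asked of [f]. *)
pose f u := lemb (s (subg G u.1, u.2)).
have [|g Gg fE] := mrep_rigid rS (f := f).
  split=> [u _|u v Gu Gv|u v Gu Gv]; first exact: lemb_in.
    by move/lemb_inj/perm_inj/(congr1 lemb); rewrite !lembK.
  by rewrite -[larc _ _ _]/(ldigraph _ _) sA /ldigraph !lembK.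
exists (subg G g)^-1; rewrite ?inE //; apply/permP=> v; apply: lemb_inj.
have := fE _ (lemb_in v); rewrite /f /= sgvalK -surjective_pairing => ->.
by rewrite permE /lshift invgK /lemb /= subgK.
Qed.

Lemma mDRR_of_mrep : has_mDRR G m.
Proof.
exists (subg_of G * 'I_m)%type, ldigraph.
have [sSG irr oS iS _] := rS.
have isoG : lperm_morphism @* [set: subg_of G] \isog G.
  rewrite isog_sym (isog_trans (isog_subg G)) //.
  exact: sub_isog (subsetT _) injm_lperm.
split.
- by move=> v; rewrite /ldigraph /larc mulVg irr.
- exists d => v; split.
    rewrite -(oS v.2) -(card_out S (lemb v)) -(card_imset _ lemb_inj).
    apply: eq_card => w; rewrite inE; apply/imsetP/idP => [[w' +->]|vw]; first by rewrite inE.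
    have Gw : w \in layers m G by rewrite in_layers -(larc_in sSG vw) subgP.
    by exists (subg G w.1, w.2); rewrite ?lembK // inE /ldigraph lembK.
  rewrite -(iS v.2) -(card_in S (lemb v)) -(card_imset _ lemb_inj).
  apply: eq_card => w; rewrite inE; apply/imsetP/idP => [[w' +->]|vw]; first by rewrite inE.
  have Gw : w \in layers m G by rewrite in_layers (larc_in sSG vw) subgP.
  by exists (subg G w.1, w.2); rewrite ?lembK // inE /ldigraph lembK.
- exists (lperm_morphism @* [set: subg_of G])%G; split=> //.
  + by rewrite Aut_ldigraph.
  + move=> _ v /morphimP[g _ _ ->]; rewrite permE => gv.
    suff -> : g = 1 by rewrite morph1.
    by move/(congr1 fst): gv => /= /(canRL (mulgK _)) /eqP; rewrite mulgV invg_eq1 => /eqP.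
  have orbE v : orbit 'P (lperm_morphism @* [set: subg_of G])%G v = [set w | w.2 == v.2].
    apply/setP=> w; rewrite inE; apply/orbitP/eqP => [[_ /morphimP[g _ _ ->] <-]|wv].
      by rewrite /= apermE permE.
    exists (lperm (v.1 * w.1^-1)); first by rewrite (mem_morphim lperm_morphism) ?inE.
    rewrite /= apermE permE /lshift invMg invgK mulgKV -wv; by case: w {wv}.
  rewrite (eq_imset _ orbE) -[RHS]card_ord -cardsT.
  rewrite -(card_imset [set: 'I_m] (f := fun i => [set w : V | w.2 == i])); last first.
    by move=> i j /setP/(_ (1, i)); rewrite !inE eqxx => /esym/eqP.
  apply: eq_card => X; apply/imsetP/imsetP => [[v _ ->]|[i _ ->]]; first by exists v.2.
  by exists (1, i).
by rewrite Aut_ldigraph.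
Qed.

End Realization.

Lemma good_mDRR (gT : finGroupType) (G : {group gT}) m : good m G -> has_mDRR G m.
Proof.
case=> S [d rS dG]; apply: (mDRR_of_mrep _ rS).
by case: m S rS dG => // S _; rewrite muln0 ltn0 andbF.
Qed.

(** * Several layers, nontrivial group *)

(** On a finite set an injective map that sends a subset into itself sends it onto itself, so no
    vertex outside the subset can enter it. *)
Lemma layer_aut_closed (gT : finGroupType) m (G : {group gT}) S f
    (P : pred (gT * 'I_m)) :
  layer_aut G S f -> {in layers m G, forall u, P u -> P (f u)} ->
  {in layers m G, forall u, P (f u) = P u}.
Proof.
case=> fG fI _ fP u Gu; apply/idP/idP; last exact: fP.
pose X := [set v in layers m G | P v].
have fX : f @: X = X.
  apply/eqP; rewrite eqEcard card_in_imset => [|v w /setIdP[Gv _] /setIdP[Gw _]].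
    rewrite leqnn andbT; apply/subsetP=> _ /imsetP[v /setIdP[Gv Pv] ->].
    by apply/setIdP; rewrite fG ?fP.
  exact: fI.
move=> Pfu; have : f u \in f @: X by rewrite fX; apply/setIdP; rewrite fG.
by case/imsetP=> v /setIdP[Gv Pv] /(fI _ _ Gu Gv) ->.
Qed.

Lemma sum_ord_eq m k : (\sum_(j < m) (j == k :> nat) = (k < m))%N.
Proof.
case: (ltnP k m) => [lt_km | le_mk]; last first.
  by rewrite big1 // => j _; rewrite ltn_eqF // (leq_trans (ltn_ord j)).
rewrite (bigD1 (Ordinal lt_km)) //= eqxx big1 // => j ne_jk.
by case: eqP => // e; case/eqP: ne_jk; apply/val_inj.
Qed.

Section Path.

Variables (gT : finGroupType) (m : nat) (a b : gT).

Definition path_back (j : nat) : gT := if j == 0 then a else 1.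

(** All voltages between consecutive layers are 1, except [a] from layer 1 down to layer 0. With the
    arcs of voltage [a] inside layer 0 this creates the transitive triangles $(x,0) \to (x,1) \to
    (xa,0)$. The arcs of voltage [b] inside the last layer complete the valency there. *)
Definition path_conn (i j : 'I_m) : {set gT} :=
  if j == i.+1 :> nat then [set 1] else
  if i == j.+1 :> nat then [set path_back j] else
  if (i == 0 :> nat) && (j == 0 :> nat) then [set a] else
  if (i == m.-1 :> nat) && (j == m.-1 :> nat) then [set b] else set0.

Hypotheses (m_gt1 : (1 < m)%N) (a1 : a != 1) (b1 : b != 1).
Hypothesis ab : m = 2%N -> a != b.

Lemma card_path_conn i j :
  #|path_conn i j| = ((j == i.+1 :> nat) + (i == j.+1 :> nat)
    + ((i == 0 :> nat) && (j == 0 :> nat))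
    + ((i == m.-1 :> nat) && (j == m.-1 :> nat)))%N.
Proof.
rewrite /path_conn; case: eqP => [e1|]; first by rewrite cards1; lia.
case: eqP => [e2|]; first by rewrite cards1; lia.
case: ifP => [e3|]; first by rewrite cards1; lia.
by case: ifP => [e4|]; rewrite ?cards1 ?cards0; lia.
Qed.

Lemma path_out i : (\sum_j #|path_conn i j| = 2)%N.
Proof.
rewrite (eq_bigr _ (fun j _ => card_path_conn i j)) !big_split /=.
rewrite sum_ord_eq.
rewrite (eq_bigr (fun j : 'I_m => (0 < i) * (j == i.-1 :> nat)))%N; last by move=> j _; lia.
rewrite -big_distrr sum_ord_eq /=.
rewrite (eq_bigr (fun j : 'I_m => (i == 0 :> nat) * (j == 0 :> nat)))%N; last by move=> j _; lia.
rewrite -big_distrr sum_ord_eq /=.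
rewrite (eq_bigr (fun j : 'I_m => (i == m.-1 :> nat) * (j == m.-1 :> nat)))%N; last by move=> j _; lia.
by rewrite -big_distrr sum_ord_eq /=; move: (ltn_ord i); lia.
Qed.

Lemma path_in i : (\sum_j #|path_conn j i| = 2)%N.
Proof.
rewrite -(path_out i); apply: eq_bigr => j _; rewrite !card_path_conn.
by congr (_ + _ + _)%N; rewrite 1?addnC 1?andbC // [X in (X + _)%N]eq_sym.
Qed.

Lemma path_arcP u v : larc path_conn u v ->
  [\/ v.2 = u.2.+1 :> nat /\ v.1 = u.1,
      u.2 = v.2.+1 :> nat /\ v.1 = u.1 * path_back v.2,
      [/\ u.2 = 0 :> nat, v.2 = 0 :> nat & v.1 = u.1 * a]
    | [/\ u.2 = m.-1 :> nat, v.2 = m.-1 :> nat & v.1 = u.1 * b]].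
Proof.
rewrite /larc /path_conn; case: ifP => [/eqP e1 | _].
  by rewrite inE -eq_mulVg1 => /eqP->; constructor 1.
case: ifP => [/eqP e1 | _].
  by rewrite inE => /eqP <-; constructor 2; rewrite mulKVg.
case: ifP => [/andP[/eqP e1 /eqP e2] | _].
  by rewrite inE => /eqP <-; constructor 3; rewrite mulKVg.
case: ifP => [/andP[/eqP e1 /eqP e2] | _]; last by rewrite inE.
by rewrite inE => /eqP <-; constructor 4; rewrite mulKVg.
Qed.

(** The critical rival is a triangle starting in the last layer: going down and up again has voltage
    [path_back (m - 2)], which is [a] for [m = 2] and 1 otherwise, hence differs from [b]. *)
Lemma path_triangle u v w :
  larc path_conn u v -> larc path_conn v w -> larc path_conn u w -> u.2 = 0 :> nat.
Proof.
have cb : path_back (m - 2) != b.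
  rewrite /path_back; case: (m - 2 =P 0)%N => [m2|_]; last by rewrite eq_sym.
  by apply: ab; move: m2; lia.
have nM (x y : gT) : x != 1 -> y * x = y -> False.
  by move=> /eqP x1 /(canRL (mulKg _)); rewrite mulVg.
have [lu lv lw] := And3 (ltn_ord u.2) (ltn_ord v.2) (ltn_ord w.2).
(* Layer indices settle all but five of the 64 combinations of arc types; in these five the voltages
   are contradictory. *)
move=> /path_arcP[[p P]|[p P]|[p q P]|[p q P]]
       /path_arcP[[r Q]|[r Q]|[r t Q]|[r t Q]]
       /path_arcP[[x R]|[x R]|[x y R]|[x y R]]; try lia.
- by case: (nM b u.1 b1); rewrite -{1}P -Q R.
- case/eqP: cb; apply: (mulgI u.1); rewrite -R Q P; congr (_ * path_back _).
  by move: p x; lia.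
- by case: (nM a v.1 a1); rewrite -Q R P r; congr (_ * path_back _); lia.
- by case: (nM b u.1 b1); apply: (mulIg (path_back w.2)); rewrite -P -Q R.
- by case: (nM b v.1 b1); rewrite -Q R P.
Qed.

Let K := <<[set a; b]>>%G.
Let Ka : a \in K. Proof. by rewrite mem_gen ?set21. Qed.
Let Kb : b \in K. Proof. by rewrite mem_gen ?set22. Qed.

Lemma path_arc_up x (i j : 'I_m) : j = i.+1 :> nat -> larc path_conn (x, i) (x, j).
Proof. by move=> ij; rewrite /larc /path_conn /= mulVg ij eqxx inE. Qed.

(* Layer [0] consists of the vertices starting a transitive triangle, and each
   further layer is then recognized as the remaining out-neighbours of the
   previous one. *)
Lemma path_rigid : rigid K path_conn.
Proof.
move=> f fA; have [fG fI fS] := fA.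
have m_gt0 : (0 < m)%N by apply: ltnW.
pose i0 := Ordinal m_gt0; pose i1 := Ordinal m_gt1.
have lt_m1 : (m.-1 < m)%N by rewrite prednK.
pose i9 := Ordinal lt_m1.
have arc_a x : larc path_conn (x, i0) (x * a, i0).
  by rewrite /larc /path_conn /= mulKg inE.
have arc_b x : larc path_conn (x, i9) (x * b, i9).
  rewrite /larc /path_conn /= mulKg !eqxx /=; have -> : (m.-1 == m.-1.+1) = false by lia.
  by rewrite (_ : (m.-1 == 0) = false) ?inE //; lia.
pose phi x := (f (x, i0)).1.
have f0 x : x \in K -> (f (x, i0)).2 = 0 :> nat.
  move=> Kx; apply: (@path_triangle _ (f (x, i1)) (f (x * a, i0)));
    rewrite fS ?in_layers ?groupM //; first exact: path_arc_up.
  by rewrite /larc /path_conn /= mulKg inE.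
have fE k x (i : 'I_m) : i = k :> nat -> x \in K -> f (x, i) = (phi x, i).
  have [n le_kn] := ubnP k; elim: n => // n IHn in k x i le_kn *.
  case: k => [|k] in le_kn * => Di Kx.
    have -> : i = i0 by apply: val_inj.
    by rewrite [LHS]surjective_pairing; congr (_, _); apply: val_inj; rewrite /= f0.
  have lt_km : (k < m)%N by have := ltn_ord i; lia.
  pose j := Ordinal lt_km.
  have := path_arc_up x (j := i) (i := j) Di.
  rewrite -fS ?in_layers // (IHn k x j) //.
  (* By induction [f] preserves the union of the layers up to [k], so the image of a vertex of layer
     [k.+1] lies above layer [k] and is reached by the upward arc. *)
  have low u : u \in layers m K -> ((f u).2 <= k)%N = (u.2 <= k)%N.
    apply: (layer_aut_closed (P := fun u : gT * 'I_m => (u.2 <= k)%N) fA).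
    by case=> y l; rewrite in_layers /= => Ky lk; rewrite (IHn l) //; lia.
  have := low (x, i); rewrite in_layers Kx /= Di => /(_ isT) lowi.
  case/path_arcP => /= [[p P]|[p P]|[p q P]|[p q P]]; try lia.
  by rewrite [LHS]surjective_pairing P; congr (_, _); apply: val_inj; rewrite /= p.
(* The arcs inside the first and the last layer give compatibility with [a] and with [b]. *)
have phiM y u : y \in K -> u.1 \in K -> f (u.1 * y, u.2) = ((f u).1 * y, (f u).2).
  apply: equivariant_gen => c [x i] Sc /= Kx.
  have Kc : c \in K by rewrite mem_gen.
  rewrite !(fE i) ?groupM //=; congr (_, _); case/set2P: Sc => ->.
    have := arc_a x; rewrite -fS ?in_layers ?groupM // !(fE 0) ?groupM //.
    by case/path_arcP => /= [[p P]|[p P]|[p q P]|[p q P]] //; lia.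
  have := arc_b x; rewrite -fS ?in_layers ?groupM // !(fE m.-1) ?groupM //.
  by case/path_arcP => /= [[p P]|[p P]|[p q P]|[p q P]] //; lia.
exists (phi 1); first by have := fG (1, i0); rewrite !in_layers group1; apply.
case=> x i; rewrite in_layers => Kx /=.
by rewrite -[x in LHS]mul1g (phiM x (1, i)) //= (fE i).
Qed.

Lemma path_mrep : mrep K path_conn 2.
Proof.
split=> [i j|i|i|i|].
- rewrite /path_conn; do 4?[case: ifP => _]; rewrite ?sub0set ?sub1set ?group1 //.
  by rewrite /path_back; case: ifP.
- rewrite /path_conn (ltn_eqF (ltnSn i)).
  by do 2?[case: ifP => _]; rewrite ?inE // eq_sym.
- exact: path_out.
- exact: path_in.
exact: path_rigid.
Qed.

End Path.

(** If [a] generates [G], the path digraph itself serves. Otherwise [a] and an element outside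
    [<[a]>] generate at least four elements, so $2\cdot 2+2 < 4m$ and the complement of the path
    digraph is dense. *)
Lemma mDRR_multilayer (gT : finGroupType) (G : {group gT}) m :
  (1 < m)%N -> (1 < #|G|)%N -> (m = 2%N -> (2 < #|G|)%N) ->
  has_mDRR G m.
Proof.
move=> m1; rewrite cardG_gt1 => /trivgPn[a Ga a1] G2.
have m0 : (0 < m)%N by apply: ltnW.
have [sGa | /subsetPn[b Gb nab]] := boolP (G \subset <[a]>).
  have defG : <[a]> = G by apply/eqP; rewrite eqEsubset sGa cycle_subG Ga.
  (* Two layers require distinct end voltages; the square of [a] is nontrivial because [G] then has
     more than two elements. *)
  pose c := if m == 2 then a ^+ 2 else a.
  have c1 : c != 1.
    rewrite /c; case: (m =P 2%N) => // /G2; rewrite -defG -orderE => o2.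
    by rewrite -order_dvdn; apply: contraL o2 => /dvdn_leq; rewrite -leqNgt; apply.
  have ac : m = 2%N -> a != c.
    by rewrite /c => ->; rewrite eqxx expgS -{1}[a]mulg1 (inj_eq (mulgI _)) eq_sym.
  apply: (mDRR_of_mrep m0 (S := @path_conn _ m a c) (d := 2)).
  have := path_mrep m1 a1 c1 ac; congr (mrep _ _ _).
  apply: val_inj; rewrite /= -[RHS]defG; apply/eqP; rewrite eqEsubset; apply/andP; split.
    rewrite gen_subG subUset !sub1set cycle_id /c.
    by case: ifP => _; rewrite ?mem_cycle ?cycle_id.
  by rewrite cycle_subG mem_gen ?set21.
have ab : a != b by apply: contraNneq nab => <-; rewrite cycle_id.
have b1 : b != 1 by apply: contraNneq nab => ->.
apply: good_mDRR; apply: (@good_supergroup _ _ <<[set a; b]>>%G); last first.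
  by rewrite gen_subG subUset !sub1set Ga.
apply: (small_good (path_mrep m1 a1 b1 (fun _ => ab))) => //.
have sK : <[a]> \subset <<[set a; b]>>%G by rewrite cycle_subG mem_gen ?set21.
have : (1 < #|<<[set a; b]>>%G : <[a]>|)%N.
  by rewrite indexg_gt1; apply: contra nab => /subsetP; apply; rewrite mem_gen ?set22.
have : (1 < #|<[a]>|)%N by rewrite cardG_gt1 cycle_eq1.
rewrite -(Lagrange sK) /=; nia.
Qed.

(** * Several layers, trivial group *)

Section TrivialGroup.

Variables (gT : finGroupType) (G : {group gT}) (n : nat).
Hypothesis oG : #|G| = 1%N.
Local Notation m := n.+4.+2.

Definition asym_next i := if i == n.+4.+1 then 0 else i.+1.
(* Exchanges [0] and [2], and cycles [1 -> n.+4.+1 -> n.+4 -> ... -> 4 -> 3 -> 1]. *)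
Definition asym_skip i :=
  match i with 0 => 2 | 1 => n.+4.+1 | 2 => 0 | 3 => 1 | k.+1 => k end%N.
Definition asym_arc (i j : nat) := (j == asym_next i) || (j == asym_skip i).

Definition asym_conn (i j : 'I_m) : {set gT} :=
  if asym_arc i j then [set 1] else set0.

Lemma asym_next_lt i : (i < m)%N -> (asym_next i < m)%N.
Proof. by rewrite /asym_next; case: eqP => //; lia. Qed.

Lemma asym_skip_lt i : (i < m)%N -> (asym_skip i < m)%N.
Proof. by case: i => [|[|[|[|i]]]] //=; lia. Qed.

Lemma asym_next_skip i : asym_next i != asym_skip i.
Proof. by rewrite /asym_next; case: i => [|[|[|[|i]]]] //=; case: ifP => //; lia. Qed.

Lemma asym_irr i : (i < m)%N -> asym_arc i i = false.
Proof.
rewrite /asym_arc /asym_next; case: i => [|[|[|[|i]]]] //= lim.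
by case: ifP; lia.
Qed.

(** [asym_prev] and [asym_back] are the inverses of [asym_next] and [asym_skip]; they count the
    in-neighbours. *)
Definition asym_prev i := if i is k.+1 then k else n.+4.+1.
Definition asym_back i :=
  match i with 0 => 2 | 1 => 3 | 2 => 0
  | _ => if i == n.+4.+1 then 1 else i.+1 end%N.

Lemma asym_prevE i j : (i < m)%N -> (j < m)%N -> (j == asym_next i) = (i == asym_prev j).
Proof. by rewrite /asym_next /asym_prev; case: j => [|j] im jm; case: ifP; lia. Qed.

Lemma asym_backE i j : (i < m)%N -> (j < m)%N -> (j == asym_skip i) = (i == asym_back j).
Proof.
by case: i => [|[|[|[|i]]]]; case: j => [|[|[|j]]] //= im jm; try case: ifP; lia.
Qed.

Lemma asym_prev_back i : (i < m)%N -> asym_prev i != asym_back i.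
Proof. by case: i => [|[|[|i]]] //= im; case: ifP => //; lia. Qed.

Lemma asym_back_lt i : (i < m)%N -> (asym_back i < m)%N.
Proof. by case: i => [|[|[|i]]] //= im; case: ifP; lia. Qed.

Lemma asym_prev_lt i : (i < m)%N -> (asym_prev i < m)%N.
Proof. by case: i => //= i; lia. Qed.

Lemma card_asym_conn i j : #|asym_conn i j| = asym_arc i j.
Proof. by rewrite /asym_conn; case: ifP; rewrite ?cards1 ?cards0. Qed.

Lemma sum_ord_eq2 k p q : (p < k)%N -> (q < k)%N -> p != q ->
  (\sum_(j < k) ((j == p :> nat) || (j == q :> nat)) = 2)%N.
Proof.
move=> pk qk npq; rewrite (eq_bigr (fun j : 'I_k => (j == p :> nat) + (j == q :> nat)))%N.
  by rewrite big_split /= !sum_ord_eq pk qk.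
by move=> j _; case: eqP => // ->; rewrite (negPf npq).
Qed.

Lemma asym_out i : (\sum_j #|asym_conn i j| = 2)%N.
Proof.
rewrite (eq_bigr _ (fun j _ => card_asym_conn i j)).
by rewrite sum_ord_eq2 ?asym_next_lt ?asym_skip_lt ?asym_next_skip.
Qed.

Lemma asym_in i : (\sum_j #|asym_conn j i| = 2)%N.
Proof.
rewrite (eq_bigr (fun j : 'I_m => (j == asym_prev i :> nat) || (j == asym_back i :> nat) : nat)).
  by rewrite sum_ord_eq2 ?asym_prev_lt ?asym_back_lt ?asym_prev_back.
by move=> j _; rewrite card_asym_conn /asym_arc asym_prevE ?asym_backE.
Qed.

(** This single transitive triangle anchors rigidity: automorphisms must fix 0, 1 and 2. *)
Lemma asym_triangle i j k : (i < m)%N ->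
  asym_arc i j -> asym_arc j k -> asym_arc i k -> [/\ i = 0, j = 1 & k = 2]%N.
Proof.
move=> im; rewrite {1 3}/asym_arc.
have [nm sm] := (asym_next_lt im, asym_skip_lt im).
case/orP=> /eqP-> jk /orP[] /eqP Dk; rewrite Dk ?asym_irr // in jk *.
  by move: jk; rewrite /asym_arc /asym_next; case: i im {nm sm Dk} => [|[|[|[|i]]]] //= im;
     do ?[case: ifP => ? //=]; (try split); lia.
by move: jk; rewrite /asym_arc /asym_next; case: i im {nm sm Dk} => [|[|[|[|[|i]]]]] //= im;
   do ?[case: ifP => ? //=]; (try split); lia.
Qed.

Lemma asym_rigid : rigid G asym_conn.
Proof.
move=> f [fG fI fA].
have G1 x : x \in G -> x = 1 by rewrite (card1_trivg oG) => /set1P.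
pose s i := (f (1, i)).2.
have G1i i : (1, i) \in layers m G by rewrite in_layers group1.
have fE i : f (1, i) = (1, s i).
  rewrite [LHS]surjective_pairing; congr (_, _); apply: G1.
  by have := fG (1, i); rewrite !in_layers group1; apply.
have sI : injective s.
  by move=> i j sij; have := fI _ _ (G1i i) (G1i j); rewrite !fE sij => /(_ erefl) [].
have sA i j : asym_arc (s i) (s j) = asym_arc i j.
  have := fA (1, i) (1, j) (G1i _) (G1i _).
  by rewrite !fE /larc /asym_conn /= mulVg; do 2!case: ifP; rewrite !inE ?eqxx.
have m0 : (0 < m)%N by []. have m1 : (1 < m)%N by []. have m2 : (2 < m)%N by [].
have [s0 s1 s2] : [/\ s (Ordinal m0) = 0 :> nat, s (Ordinal m1) = 1 :> nat
                    & s (Ordinal m2) = 2 :> nat]%N.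
  by apply: asym_triangle; rewrite ?ltn_ord ?sA.
(* For [k] at least 3 the out-neighbours of [k.-1] are [k] and a vertex below [k]. The latter is
   already fixed, so injectivity leaves only [k]. *)
have sE (k : nat) (i : 'I_m) : i = k :> nat -> s i = k :> nat.
  have [N] := ubnP k; elim: N => // N IHn in k i *; rewrite ltnS => le_kn Dk.
  have [k0 | k_gt0] := posnP k.
    by rewrite (_ : i = Ordinal m0) ?s0 //; apply: val_inj => /=; lia.
  have [k1 | k_ne1] := eqVneq k 1%N.
    by rewrite (_ : i = Ordinal m1) ?s1 //; apply: val_inj => /=; lia.
  have [k2 | k_ne2] := eqVneq k 2%N.
    by rewrite (_ : i = Ordinal m2) ?s2 //; apply: val_inj => /=; lia.
  have lt_jm : (k.-1 < m)%N by have := ltn_ord i; lia.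
  have := sA (Ordinal lt_jm) i; rewrite (IHn k.-1) //=; last by lia.
  have -> : asym_arc k.-1 i.
    by rewrite /asym_arc /asym_next Dk; have := ltn_ord i; case: ifP; lia.
  have [// | ne_sk] := eqVneq (s i : nat) k.
  have [lt_sk | ge_sk] := ltnP (s i) k.
    by move=> _; have /(congr1 val)/= := sI _ _ (val_inj (IHn _ (s i) (leq_trans lt_sk le_kn) erefl)); lia.
  rewrite /asym_arc /asym_next; case/orP => /eqP Ds; move: Ds ge_sk ne_sk k_gt0 k_ne1 k_ne2.
    by case: ifP; have := ltn_ord i; lia.
  by case: (k) => [|[|[|[|[|k']]]]] //= ->; lia.
exists 1 => // -[x i]; rewrite in_layers => /G1 /= ->.
by rewrite fE mulg1; congr (_, _); apply: val_inj; apply: sE.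
Qed.

Lemma asym_mrep : mrep G asym_conn 2.
Proof.
split=> [i j|i|i|i|].
- by rewrite /asym_conn; case: ifP; rewrite ?sub0set ?sub1set.
- by rewrite /asym_conn asym_irr ?inE.
- exact: asym_out.
- exact: asym_in.
exact: asym_rigid.
Qed.

End TrivialGroup.

(** * One layer: small connection sets *)

(* The embeddings of the first [k] of [n] vertices into the structure on [n]
   vertices given by the arcs [M] and the labels [R], as lists of images. *)
Fixpoint embeds (M : nat -> nat -> bool) (R : nat -> bool) (n k : nat) : seq (seq nat) :=
  if k is l.+1 then
    flatten [seq [seq rcons p w | w <- iota 0 n &
        [&& w \notin p, R w == R l &
            all (fun i => (M (nth 0 p i) w == M i l) && (M w (nth 0 p i) == M l i))
              (iota 0 l)]]
      | p <- embeds M R n l]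
  else [:: [::]].

Definition asymmetric M R n := embeds M R n n == [:: iota 0 n].

(** By induction on [k], the list of the first [k] values of [f] survives the filter in [embeds];
    for [k = n] only the identity list is left. *)
Lemma asymmetricP M R n (f : nat -> nat) : asymmetric M R n ->
    (forall i, i < n -> f i < n)%N ->
    (forall i j, i < n -> j < n -> f i = f j -> i = j)%N ->
    (forall i j, i < n -> j < n -> M (f i) (f j) = M i j)%N ->
    (forall i, i < n -> R (f i) = R i)%N ->
  forall i, (i < n)%N -> f i = i.
Proof.
move=> /eqP asymM fn fI fM fR.
have iotaS k : iota 0 k.+1 = rcons (iota 0 k) k by rewrite -addn1 iotaD cats1.
have emb k : (k <= n)%N -> [seq f i | i <- iota 0 k] \in embeds M R n k.
  elim: k => [|k IHk] le_kn //.
  rewrite [embeds _ _ _ _]/= iotaS map_rcons; apply/flattenP.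
  exists [seq rcons [seq f i | i <- iota 0 k] w | w <- iota 0 n &
        [&& w \notin [seq f i | i <- iota 0 k], R w == R k &
            all (fun i => (M (nth 0 [seq f i | i <- iota 0 k] i) w == M i k)
               && (M w (nth 0 [seq f i | i <- iota 0 k] i) == M k i)) (iota 0 k)]].
    by apply/mapP; exists [seq f i | i <- iota 0 k]; rewrite ?IHk // ltnW.
  apply/mapP; exists (f k) => //.
  rewrite mem_filter mem_iota fn // fR // eqxx !andbT /=; apply/andP; split.
    apply/mapP=> -[i]; rewrite mem_iota /= => lik /fI e.
    by have := e le_kn (ltn_trans lik le_kn); lia.
  apply/allP=> i; rewrite mem_iota /= => lik.
  by rewrite (nth_map 0) ?size_iota ?nth_iota // !fM ?eqxx // (ltn_trans lik).
have := emb n (leqnn n); rewrite asymM inE => /eqP e i lin.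
have := congr1 (nth 0 ^~ i) e.
by rewrite (nth_map 0) ?size_iota // nth_iota.
Qed.

(** * Rigidity from the digraph induced on the out-neighbours of the identity *)

Section Local.

Variable (gT : finGroupType).
Implicit Types (T : {set gT}) (s : seq gT).

(* An automorphism [f] induces, for each vertex [g], the permutation
   [t |-> (f g)^-1 * f (g * t)] of the out-neighbours of the identity. *)
Lemma local_mrep T :
    1 \notin T ->
    (forall f : gT -> gT, {in T, forall t, f t \in T} -> {in T &, injective f} ->
       {in T &, forall t u, ((f t)^-1 * f u \in T) = (t^-1 * u \in T)} ->
       {in T, forall t, ((f t)^-1 \in T) = (t^-1 \in T)} ->
       {in T, f =1 id}) ->
  mrep <<T>>%G (fun _ _ : 'I_1 => T) #|T|.
Proof.
move=> T1 rigT; split=> // [*||*|].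
- exact: subset_gen.
- by move=> i; rewrite big_ord1.
- by rewrite big_ord1.
move=> f [fG fI fA].
pose phi x := (f (x, ord0)).1.
have fE x i : f (x, i) = (phi x, ord0) by rewrite ord1 [LHS]surjective_pairing [_.2]ord1.
have phiG x : x \in <<T>> -> phi x \in <<T>>.
  by move=> Gx; have := fG (x, ord0); rewrite fE !in_layers; apply.
have phiI : {in <<T>> &, injective phi}.
  move=> x y Gx Gy e; have := fI (x, ord0) (y, ord0); rewrite !fE !in_layers /= e.
  by case/(_ Gx Gy erefl).
have phiA : {in <<T>> &, forall x y, ((phi x)^-1 * phi y \in T) = (x^-1 * y \in T)}.
  by move=> x y Gx Gy; have := fA (x, ord0) (y, ord0); rewrite !fE !in_layers; apply.
have GT t : t \in T -> t \in <<T>> by apply/mem_gen.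
have phiM x t : x \in <<T>> -> t \in T -> phi (x * t) = phi x * t.
  move=> Gx Tt; apply: (mulgI (phi x)^-1); rewrite mulKg.
  have Gxt u : u \in T -> x * u \in <<T>> by move/GT; apply: groupM.
  apply: (rigT (fun u => (phi x)^-1 * phi (x * u))) => // [u Tu|u v Tu Tv|u v Tu Tv|u Tu].
  - by rewrite phiA ?Gxt // mulKg.
  - by move/mulgI/(phiI _ _ (Gxt _ Tu) (Gxt _ Tv))/mulgI.
  - by rewrite invMg invgK mulgA mulgK phiA ?Gxt // invMg -mulgA mulKg.
  - by rewrite invMg invgK phiA ?Gxt // invMg mulgKV.
have fM y u : y \in <<T>> -> u.1 \in <<T>> -> f (u.1 * y, u.2) = ((f u).1 * y, (f u).2).
  by apply: equivariant_gen => t [z j] Tt /= Gz; rewrite !fE /= phiM.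
exists (phi 1); first exact: phiG.
case=> x i; rewrite in_layers /= => Gx.
by have := fM x (1, i) Gx (group1 _); rewrite /= mul1g => ->; rewrite fE [i]ord1.
Qed.

(** Positions in [s] replace elements, so that rigidity becomes a finite check: [M] tabulates the
    arcs among the out-neighbours of 1, and [R] marks those with an arc back to 1. *)
Lemma local_mrep_seq s (M : nat -> nat -> bool) (R : nat -> bool) :
    uniq s -> 1 \notin s ->
    (forall i j, (i < size s)%N -> (j < size s)%N ->
       ((nth 1 s i)^-1 * nth 1 s j \in s) = M i j) ->
    (forall i, (i < size s)%N -> ((nth 1 s i)^-1 \in s) = R i) ->
    asymmetric M R (size s) ->
  mrep <<[set x in s]>>%G (fun _ _ : 'I_1 => [set x in s]) (size s).
Proof.
move=> Us s1 sM sR asymM.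
have := @local_mrep [set x in s]; rewrite cardsE (card_uniqP Us); apply; first by rewrite inE.
move=> f fT fI fA fR t; rewrite inE => st.
have {}fT u : u \in s -> f u \in s by move: (fT u); rewrite !inE.
have ns i : (i < size s)%N -> nth 1 s i \in s by apply: mem_nth.
have Tn i : (i < size s)%N -> nth 1 s i \in [set x in s] by rewrite inE; apply: ns.
pose h i := index (f (nth 1 s i)) s.
have hE i : (i < size s)%N -> nth 1 s (h i) = f (nth 1 s i).
  by move=> si; rewrite nth_index ?fT ?ns.
have hs i : (i < size s)%N -> (h i < size s)%N by move=> si; rewrite index_mem fT ?ns.
have := asymmetricP (f := h) asymM hs.
move=> /(_ _ _ _ (index t s)); rewrite index_mem => hid.
rewrite -{2}(nth_index 1 st) -[in RHS]hid //; first by rewrite hE ?index_mem // nth_index.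
- move=> i j si sj /(congr1 (nth 1 s)); rewrite !hE // => /fI; rewrite !Tn // => /(_ isT isT)/eqP.
  by rewrite nth_uniq // => /eqP.
- move=> i j si sj; rewrite -!sM ?hs // !hE //.
  by have := fA _ _ (Tn _ si) (Tn _ sj); rewrite !inE.
- by move=> i si; rewrite -!sR ?hs // hE //; have := fR _ (Tn _ si); rewrite !inE.
Qed.

(* Elements are represented by codes [c] with [e c] the element and [dv] the
   left division, so that rigidity becomes a computation on codes. *)
Lemma coded_mrep (C : eqType) (e : C -> gT) (dv : C -> C -> C) (ok : pred C) (o : C)
    (cs : seq C) :
    {in ok &, injective e} ->
    {in ok &, forall c d, (e c)^-1 * e d = e (dv c d)} ->
    {in ok &, forall c d, dv c d \in ok} -> e o = 1 -> o \in ok ->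
    all ok cs -> uniq cs -> o \notin cs ->
    asymmetric (fun i j => dv (nth o cs i) (nth o cs j) \in cs)
      (fun i => dv (nth o cs i) o \in cs) (size cs) ->
  mrep <<[set x in map e cs]>>%G (fun _ _ : 'I_1 => [set x in map e cs]) (size cs).
Proof.
move=> eI eD okD eo ok_o /allP okcs Ucs ncs asymM.
have mem_e c : c \in ok -> (e c \in map e cs) = (c \in cs).
  move=> okc; apply/mapP/idP => [[d cd /eI]|]; last by exists c.
  by move=> /(_ okc (okcs _ cd)) ->.
have okn i : (i < size cs)%N -> nth o cs i \in ok by move=> ?; apply/okcs/mem_nth.
have nth_e i : (i < size cs)%N -> nth 1 (map e cs) i = e (nth o cs i).
  by move=> ?; rewrite (nth_map o).
have := @local_mrep_seq (map e cs) (fun i j => dv (nth o cs i) (nth o cs j) \in cs)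
  (fun i => dv (nth o cs i) o \in cs).
rewrite size_map; apply=> //.
- by rewrite map_inj_in_uniq // => c d /okcs okc /okcs okd; apply: eI.
- by rewrite -eo mem_e.
- by move=> i j si sj; rewrite !nth_e // eD ?okn // mem_e ?okD ?okn.
- by move=> i si; rewrite nth_e // -[_^-1]mulg1 -eo eD ?okn // mem_e ?okD ?okn.
Qed.

End Local.

(** * Connection sets with at most three elements *)

Section SmallSets.

Variable gT : finGroupType.
Implicit Types (a b c t : gT) (G : {group gT}).

Definition table (L : seq (seq bool)) (i j : nat) := nth false (nth [::] L i) j.

Lemma order_gt2 a : (2 < #[a])%N -> (a != 1) && (a * a != 1).
Proof.
move=> a2; apply/andP; split; first by rewrite -order_gt1 ltnW.
by apply: contraTneq a2 => aa; rewrite -leqNgt dvdn_leq // order_dvdn expgS expg1 aa.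
Qed.

Lemma mrep1 : exists S, mrep (m := 1) (1%G : {group gT}) S 0.
Proof.
exists (fun _ _ => [set x in [::]]).
have := @local_mrep_seq gT [::] (fun _ _ => false) xpred0 isT isT.
by move=> /(_ _ _ isT); rewrite (_ : <<_>>%G = 1%G) //=; [apply|apply: val_inj; rewrite /= set_nil gen0].
Qed.

Lemma mrep_cycle a : a != 1 -> exists S, mrep (m := 1) <[a]>%G S 1.
Proof.
move=> a1; exists (fun _ _ => [set x in [:: a]]).
have := @local_mrep_seq gT [:: a] (fun _ _ => false) (fun _ => a^-1 \in [:: a]).
rewrite (_ : <<_>>%G = <[a]>%G); last by apply: val_inj; rewrite /= set_cons set_nil setU0.
apply=> //.
- by rewrite inE eq_sym.
- by case=> // -[] // _ _; rewrite mulVg inE eq_sym (negPf a1).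
- by case.
by rewrite /asymmetric /=; case: (_ \in _).
Qed.

Lemma gen2 a b : <<[set x in [:: a; b]]>>%G = <<[set a; b]>>%G.
Proof. by apply: val_inj; rewrite /= !set_cons set_nil setU0. Qed.

(** The labels alone separate the two out-neighbours: [b] has an arc back to 1 and [a] has none. The
    arcs between them may be arbitrary. *)
Lemma mrep_involution a b : (2 < #[a])%N -> #[b] = 2%N ->
  exists S, mrep (m := 1) <<[set a; b]>>%G S 2.
Proof.
move=> /order_gt2/andP[a1 aa1] ob.
have b1 : b != 1 by rewrite -order_gt1 ob.
have bb : b^-1 = b by apply/eqP; rewrite eq_invg_mul -(expg_order b) ob expgS expg1.
have ab : a != b by apply: contraNneq aa1 => ->; rewrite -{1}bb mulVg.
exists (fun _ _ => [set x in [:: a; b]]); rewrite -gen2.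
apply: (@local_mrep_seq _ [:: a; b]
  (table [:: [:: false; a^-1 * b \in [:: a; b]]; [:: b^-1 * a \in [:: a; b]; false]])
  (fun i => i == 1%N)).
- by rewrite /= inE ab.
- by rewrite !inE !(eq_sym 1) negb_or a1.
- by case=> [|[|]] // [|[|]] // _ _; rewrite /table /= mulVg !inE !(eq_sym 1) (negPf a1) (negPf b1).
- case=> [|[|]] //= _; rewrite !inE ?bb ?eqxx ?orbT //.
  by rewrite eq_invg_mul (negPf aa1) eq_invg_sym bb (negPf ab).
by rewrite /asymmetric /=; do 2!case: (_ \in _).
Qed.


(** Among [a], [b] and [a * b] there is always the arc $a \to ab$. The only other possible arcs are
    $b \to a$, which forces $b^a=b^{-1}$, and $ab \to b$, which forces $a^b=a^{-1}$. Unless both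
    occur and close a directed triangle, the local digraph is asymmetric. *)
Lemma mrep_noncommuting a b : (2 < #[a])%N -> (2 < #[b])%N -> a * b != b * a ->
    ~~ ((a ^ b == a^-1) && (b ^ a == b^-1)) ->
  exists S, mrep (m := 1) <<[set a; b]>>%G S 3.
Proof.
move=> /order_gt2/andP[a1 aa1] /order_gt2/andP[b1 bb1] nc nQ.
(* As [a] and [b] do not commute, neither is a power of the other; unwanted coincidences are reduced
   to this. *)
have nab n : b <> a ^+ n by move=> e; case/eqP: nc; rewrite e -expgS -expgSr.
have nba n : a <> b ^+ n by move=> e; case/eqP: nc; rewrite e -expgS -expgSr.
have nabV n : b <> a ^- n by move=> e; case/eqP: nc; rewrite e; apply/commuteV/commuteX.
have nbaV n : a <> b ^- n by move=> e; case/eqP: nc; rewrite e; apply/esym/commuteV/commuteX.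
have VE (x : gT) : (x * x != 1) -> x^-1 <> x by move=> /eqP xx e; apply: xx; apply/eqP; rewrite -eq_invg_mul e.
set s := [:: a; b; a * b].
have defK : <<[set x in s]>>%G = <<[set a; b]>>%G.
  apply/val_inj/eqP; rewrite /= eqEsubset !gen_subG; apply/andP; split; apply/subsetP=> x.
    rewrite !inE => /or3P[] /eqP->; rewrite ?groupM ?mem_gen ?set21 ?set22 //.
  by case/set2P=> ->; rewrite mem_gen // !inE eqxx ?orbT.
exists (fun _ _ => [set x in s]); rewrite -defK.
have arc_ba : (b^-1 * a \in s) -> b ^ a = b^-1.
  rewrite !inE => /or3P[]/eqP e.
  - by case/eqP: b1; apply: invg_inj; apply: (mulIg a); rewrite e invg1 mul1g.
  - by case: (nba 2); rewrite expgS expg1 -{2}e mulKVg.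
  by apply: invg_inj; rewrite -conjVg conjgE e mulKg invgK.
have arc_cb : ((a * b)^-1 * b \in s) -> a ^ b = a^-1.
  rewrite !inE invMg => /or3P[]/eqP e.
  - by apply: invg_inj; rewrite -conjVg conjgE mulgA e invgK.
  - case: (nabV 1%N); rewrite expg1; apply: (mulgI b^-1); apply: (mulIg b).
    by rewrite mulVg mul1g e.
  case: (nabV 2); rewrite expgS expg1 invMg; apply: (mulgI a); rewrite mulKVg.
  by rewrite -(mulIg _ _ _ e) invMg !invgK.
have bNa : b == a = false by apply/eqP=> e; apply: (nab 1%N).
have abNa : a * b == a = false.
  by rewrite -[X in _ == X]mulg1 (inj_eq (mulgI a)) (negPf b1).
have abNb : a * b == b = false.
  by rewrite -[X in _ == X]mul1g (inj_eq (mulIg b)) (negPf a1).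
have abN1 : a * b == 1 = false.
  by rewrite -eq_invg_mul eq_sym; apply/eqP; apply: (nabV 1%N).
have s1 : 1 \notin s by rewrite !inE !(eq_sym 1) (negPf a1) (negPf b1) abN1.
apply: (@local_mrep_seq _ s
  (table [:: [:: false; false; true]; [:: b^-1 * a \in s; false; false];
             [:: false; (a * b)^-1 * b \in s; false]])
  (fun i => (i == 2) && ((a * b)^-1 \in s))) => //.
- by rewrite /= !inE eq_sym bNa eq_sym abNa eq_sym abNb.
- case=> [|[|[|]]] // [|[|[|]]] // _ _; rewrite /table /= ?mulVg ?(negPf s1) //.
  + apply/negP; rewrite !inE => /or3P[]/eqP e.
    * by apply: (nab 2); rewrite expgS expg1 -{2}e mulKVg.
    * by case/eqP: a1; apply: invg_inj; apply: (mulIg b); rewrite e invg1 mul1g.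
    * by move/mulIg/VE: e; apply.
  + by rewrite mulKg !inE eqxx orbT.
  + apply/negP; rewrite !inE => /or3P[]/eqP e.
    * by case/eqP: nc; rewrite -{2}e mulKVg.
    * by move/eqP: bNa; apply; apply/esym/(mulIg b)/(canRL (mulKVg b) e).
    * by case/eqP: b1; apply: invg_inj; apply: (mulIg (a * b)); rewrite e invg1 mul1g.
  + rewrite invMg mulgKV; apply/negP; rewrite !inE => /or3P[]/eqP e.
    * by apply: (nbaV 1%N); rewrite expg1.
    * exact: VE e.
    * by apply: (nbaV 2); rewrite expgS expg1 invMg {1}e mulgK.
- case=> [|[|[|]]] // _ /=; apply/negP; rewrite !inE => /or3P[]/eqP e.
  + exact: VE e.
  + by apply: (nabV 1%N); rewrite expg1.
  + by apply: (nabV 2); rewrite expgS expg1 invMg {2}e mulKg.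
  + by apply: (nbaV 1%N); rewrite expg1.
  + exact: VE e.
  + by apply: (nbaV 2); rewrite expgS expg1 invMg {1}e mulgK.
move: nQ arc_ba arc_cb; case: (_ * a \in s) => [nQ /(_ isT) e1 | _ _].
  case: (_ * b \in s) => [/(_ isT) e2 | _]; first by rewrite e1 e2 !eqxx in nQ.
  by rewrite /asymmetric /=; case: (_ \in _).
by rewrite /asymmetric /=; do 2!case: (_ \in _).
Qed.

(* When [b * b = a * a], exchanging [a] and [b] preserves the local digraph. *)
Lemma mrep_square a b : (3 < #[a])%N -> b \notin <[a]> -> b * b != a * a ->
  exists S, mrep (m := 1) <<[set a; b]>>%G S 3.
Proof.
move=> a3 nab bbaa; have [|a1 aa1] := andP (@order_gt2 a _); first exact: ltnW.
(* For [a] of order three, $a^{-1}=a^2$ would add the arc $a^2 \to a$. *)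
have aV1 : a^-1 != a * a.
  by rewrite eq_invg_mul; apply: contraTneq a3 => aa; rewrite -leqNgt dvdn_leq // order_dvdn !expgS expg0 mulg1 aa.
have nX (x : gT) : x \in <[a]> -> (b == x) = false by move=> ax; apply: contraNF nab => /eqP->.
have aa := groupM (cycle_id a) (cycle_id a).
have nXM (x y : gT) : x \in <[a]> -> y \in <[a]> -> (x * b == y) = false.
  move=> ax ay; rewrite -(inj_eq (mulgI x^-1)) mulKg nX // groupM ?groupV //.
have b1 : b != 1 by apply: contraNneq nab => ->.
set s := [:: a; a * a; b].
have defK : <<[set x in s]>>%G = <<[set a; b]>>%G.
  apply/val_inj/eqP; rewrite /= eqEsubset !gen_subG; apply/andP; split; apply/subsetP=> x.
    rewrite !inE => /or3P[] /eqP->; rewrite ?groupM ?mem_gen ?set21 ?set22 //.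
  by case/set2P=> ->; rewrite mem_gen // !inE eqxx ?orbT.
exists (fun _ _ => [set x in s]); rewrite -defK.
have s1 : 1 \notin s by rewrite !inE !(eq_sym 1) (negPf a1) (negPf aa1) (negPf b1).
have aVs : (a^-1 \in s) = false.
  by rewrite !inE (negPf aV1) eq_invg_mul (negPf aa1) eq_sym nX // groupV cycle_id.
apply: (@local_mrep_seq _ s
  (table [:: [:: false; true; false]; [:: false; false; false]; [:: b^-1 * a \in s; false; false]])
  (nth false [:: false; (a * a)^-1 \in s; b^-1 \in s])) => //.
- rewrite /= !inE -{1}[a]mulg1 (inj_eq (mulgI a)) (eq_sym 1) (negPf a1).
  by rewrite !(eq_sym _ b) !nX ?cycle_id.
- case=> [|[|[|]]] // [|[|[|]]] // _ _; rewrite /table /= ?mulVg ?(negPf s1) //.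
  + by rewrite mulKg inE eqxx.
  + by rewrite !inE (nXM a^-1 a) ?(nXM a^-1 (a * a)) ?groupV ?cycle_id //= -[X in _ == X]mul1g (inj_eq (mulIg b)) invg_eq1 (negPf a1).
  + by rewrite invMg mulgKV.
  + by rewrite !inE (nXM (a * a)^-1 a) ?(nXM (a * a)^-1 (a * a)) ?groupV ?cycle_id //= -[X in _ == X]mul1g (inj_eq (mulIg b)) invg_eq1 (negPf aa1).
  + rewrite !inE !(can2_eq (mulKVg b) (mulKg b)) (inj_eq (mulIg a)) eq_sym nX ?cycle_id //.
    by rewrite -{1}[a * a]mul1g (inj_eq (mulIg _)) (eq_sym 1) (negPf b1) eq_sym (negPf bbaa).
- by case=> [|[|[|]]].
by rewrite /asymmetric /=; do 3!case: (_ \in _).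
Qed.

End SmallSets.

(** * Elementary abelian groups through coordinate vectors *)

Section Coded.

Variable gT : finGroupType.

Lemma isog_rV_abelem p n (E : {group gT}) : prime p -> p.-abelem E -> #|E| = (p ^ n)%N ->
  exists2 f : {morphism [set: 'rV['F_p]_n] >-> gT}, 'injm f & f @* [set: 'rV['F_p]_n] = E.
Proof.
move=> pr abE oE; apply/isogP; rewrite isog_sym (isog_abelem_card _ abE) mx_Fp_abelem //=.
by rewrite cardsT card_mx card_Fp // mul1n oE.
Qed.

Definition vec_ok p n (l : seq nat) := (size l == n) && all (fun x => x < p)%N l.
(** Left division $l^{-1}k$ in additive form, that is $k-l$; adding [p] first avoids truncated
    subtraction. *)
Definition vec_sub p n (l k : seq nat) :=
  mkseq (fun i => (nth 0 k i + (p - nth 0 l i)) %% p)%N n.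

(** The unit vectors among the codes guarantee that the connection set generates all of [E]. The
    conditions on [cs] can be decided by computation. *)
Lemma good_abelem p n (cs : seq (seq nat)) (E : {group gT}) :
    prime p -> p.-abelem E -> #|E| = (p ^ n)%N ->
    all (vec_ok p n) cs -> uniq cs -> nseq n 0%N \notin cs ->
    all (fun i => mkseq (fun j => (i == j : nat)) n \in cs) (iota 0 n) ->
    asymmetric (fun i j => vec_sub p n (nth (nseq n 0) cs i) (nth (nseq n 0) cs j) \in cs)%N
      (fun i => vec_sub p n (nth (nseq n 0) cs i) (nseq n 0) \in cs)%N (size cs) ->
    (1 < size cs)%N -> (2 * size cs + 2 < p ^ n)%N ->
  good 1 E.
Proof.
move=> pr abE oE okcs Ucs ncs basis asymM cs1 cs2.
have p0 := prime_gt0 pr.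
have [f injf imf] := isog_rV_abelem pr abE oE.
pose r (l : seq nat) : 'rV['F_p]_n := (\row_(i < n) (nth 0%N l i)%:R)%R.
have okn l i : vec_ok p n l -> (nth 0 l i < p)%N.
  case/andP=> _ /allP lp; case: (ltnP i (size l)) => [li | ?]; last by rewrite nth_default.
  by apply: lp; apply: mem_nth.
have eI : {in vec_ok p n &, injective (fun l => f (r l))}.
  move=> l k okl okk /(injmP injf); rewrite !inE => /(_ isT isT) e.
  have /andP[/eqP sl _] := okl; have /andP[/eqP sk _] := okk.
  apply: (@eq_from_nth _ 0%N) => [|i]; rewrite ?sl ?sk // => lin.
  have := congr1 (fun v : 'rV__ => val (v ord0 (Ordinal lin))) e.
  by rewrite !mxE /= !val_Fp_nat // !modn_small ?okn.
have eD : {in vec_ok p n &, forall l k, (f (r l))^-1 * f (r k) = f (r (vec_sub p n l k))}.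
  move=> l k okl okk; rewrite -morphV ?inE // -morphM ?inE //; congr (f _).
  apply/rowP=> i; rewrite !mxE nth_mkseq // Fp_nat_mod // GRing.natrD GRing.natrB; last exact/ltnW/okn.
  by rewrite pchar_Fp_0 // GRing.sub0r GRing.addrC.
have okD : {in vec_ok p n &, forall l k, vec_sub p n l k \in vec_ok p n}.
  move=> l k okl okk; rewrite unfold_in /vec_ok size_mkseq eqxx /=.
  by apply/allP=> _ /mapP[i _ ->]; rewrite ltn_mod.
have e0 : f (r (nseq n 0%N)) = 1.
  rewrite -(morph1 f); congr (f _); apply/rowP=> i.
  by rewrite !mxE nth_nseq; case: ifP.
have ok0 : nseq n 0%N \in vec_ok p n.
  by rewrite unfold_in /vec_ok size_nseq eqxx all_nseq p0 orbT.
have := coded_mrep eI eD okD e0 ok0 okcs Ucs ncs asymM.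
set W := <<_>>%G => rS.
have fW v : f v \in W.
  rewrite [v]row_sum_delta; elim/big_ind: _ => [|v1 v2 W1 W2|i _].
  - by rewrite -[X in f X]/(1 : 'rV['F_p]_n) morph1.
  - by rewrite -[X in f X]/(v1 * v2) morphM ?inE // groupM.
  rewrite -[v 0%R i]natr_Zp GRing.scaler_nat -[X in f X]/(_ ^+ _) morphX ?inE // groupX //.
  have /allP/(_ i) := basis; rewrite mem_iota ltn_ord => /(_ isT) bi.
  rewrite (_ : delta_mx 0 i = r (mkseq (fun j => (i == j :> nat) : nat) n))%R; last first.
    by apply/rowP=> j; rewrite !mxE nth_mkseq //= eq_sym.
  by rewrite mem_gen // inE (map_f (fun l => f (r l))).
have defW : W = E.
  apply: val_inj; rewrite /= -imf; apply/eqP; rewrite eqEsubset gen_subG; apply/andP; split.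
    by apply/subsetP=> x; rewrite inE => /mapP[l _ ->]; apply: mem_morphim; rewrite inE.
  by apply/subsetP=> _ /morphimP[v _ _ ->].
by rewrite -defW in oE *; apply: (small_good rS); rewrite // muln1 oE.
Qed.

End Coded.

(** * Explicit connection sets *)

Section Concrete.

Variable gT : finGroupType.
Implicit Types E G : {group gT}.

Lemma good_Z3_3 E : 3.-abelem E -> #|E| = 27%N -> good 1 E.
Proof.
move=> abE oE; apply: (@good_abelem _ 3 3 [:: [:: 1; 0; 0]; [:: 0; 1; 0]; [:: 0; 0; 1];
  [:: 0; 2; 1]; [:: 2; 0; 0]; [:: 1; 2; 0]]%N) => //; by vm_compute.
Qed.

Lemma good_Z2_5 E : 2.-abelem E -> #|E| = 32%N -> good 1 E.
Proof.
move=> abE oE; apply: (@good_abelem _ 2 5 [:: [:: 1; 0; 0; 0; 0]; [:: 0; 1; 0; 0; 0];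
  [:: 0; 0; 1; 0; 0]; [:: 0; 0; 0; 1; 0]; [:: 0; 0; 0; 0; 1]; [:: 1; 0; 0; 1; 0];
  [:: 0; 1; 1; 1; 1]; [:: 1; 1; 0; 0; 0]; [:: 1; 1; 1; 0; 1]; [:: 1; 0; 1; 0; 0];
  [:: 0; 1; 0; 0; 1]; [:: 1; 1; 0; 1; 0]; [:: 0; 1; 1; 0; 0]]%N) => //; by vm_compute.
Qed.

Definition dih_ok (u : nat * nat * bool) := (u.1.1 < 3)%N && (u.1.2 < 3)%N.
(** The code $(i,j,k)$ stands for $a^i c^j t^k$, where [t] inverts [a] and [c]. Modulo 3 the factor
    2 is a sign, so this is left division. *)
Definition dih_div (u v : nat * nat * bool) :=
  let: (i, j, k) := u in let: (i', j', k') := v in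
  if k then ((i + 2 * i') %% 3, (j + 2 * j') %% 3, ~~ k')%N
  else ((i' + 2 * i) %% 3, (j' + 2 * j) %% 3, k')%N.

(** The 18 codes give distinct elements, and the set consisting of [a], [t], [a * t] and [c * t] has
    an asymmetric local digraph. Its valency 4 is small enough, since $2\cdot 4+2 < 18$. *)
Lemma good_generalized_dihedral (a c t : gT) G :
    a \in G -> c \in G -> t \in G ->
    #[a] = 3%N -> #[c] = 3%N -> c \notin <[a]> -> commute a c ->
    t * t = 1 -> a ^ t = a^-1 -> c ^ t = c^-1 ->
  good 1 G.
Proof.
move=> Ga Gc Gt oa oc nca cac tt at_ ct.
have a3 : a ^+ 3 = 1 by rewrite -oa expg_order.
have c3 : c ^+ 3 = 1 by rewrite -oc expg_order.
have modX (x : gT) n : x ^+ 3 = 1 -> x ^+ (n %% 3) = x ^+ n := @expg_mod _ 3 n x.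
have tV : t^-1 = t by apply/eqP; rewrite eq_invg_mul tt.
have tX (x : gT) n : x ^+ 3 = 1 -> x ^ t = x^-1 -> t * x ^+ n = x ^+ (2 * n) * t.
  move=> x3 xt; rewrite conjgCV tV conjXg xt expgM; congr (_ ^+ _ * _).
  by apply/eqP; rewrite eq_invg_mul -expgS x3.
pose e (u : nat * nat * bool) := a ^+ u.1.1 * c ^+ u.1.2 * t ^+ u.2.
have ac i j k l : a ^+ i * c ^+ j * (a ^+ k * c ^+ l) = a ^+ (i + k) * c ^+ (j + l).
  rewrite !expgD -!mulgA; congr (_ * _); rewrite !mulgA; congr (_ * _).
  by apply/esym/commuteX2.
have eM i j (k : bool) u : e (i, j, k) * e u =
    if k then e (i + 2 * u.1.1, j + 2 * u.1.2, ~~ u.2)%N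
    else e (i + u.1.1, j + u.1.2, u.2)%N.
  rewrite /e /=; case: k => /=; last by rewrite mulg1 mulgA ac.
  rewrite -ac -!mulgA; congr (_ * (_ * _)); rewrite !mulgA expg1 tX // -!mulgA; congr (_ * _).
  rewrite !mulgA tX // -!mulgA; congr (_ * _).
  by case: (u.2); rewrite /= ?expg1 ?mulg1 ?tt.
have eG u : e u \in G by rewrite !groupM ?groupX.
have e_mod i j k i' j' : (i = i' %[mod 3] -> j = j' %[mod 3] -> e (i, j, k) = e (i', j', k))%N.
  by move=> ii jj; rewrite /e /= -(modX a i a3) ii (modX a _ a3) -(modX c j c3) jj (modX c _ c3).
have eD : {in dih_ok &, forall u v, (e u)^-1 * e v = e (dih_div u v)}.
  move=> [[i j] k] [[i' j'] k'] _ _; apply: (mulgI (e (i, j, k))); rewrite mulKVg eM /dih_div.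
  by case: k => /=; rewrite ?negbK; apply: e_mod; rewrite -modnDmr ?modnMmr modnDmr; lia.
(* [t] inverts [a] of order three, so it lies outside the abelian group generated by [a] and [c];
   this separates codes with different last components. *)
have tcom (x : gT) : x \in <<[set a; c]>> -> t <> x.
  move=> Ax tx; have : abelian <<[set a; c]>>.
    by rewrite abelian_gen; apply/centsP=> y /set2P[]-> z /set2P[]->.
  move/centsP => /(_ _ Ax a); rewrite mem_gen ?set21 // => /(_ isT); rewrite -tx => cta.
  have := at_; rewrite conjgE -cta mulKg => /esym/eqP.
  by rewrite eq_invg_mul -{2}[a]expg1 -expgS -order_dvdn oa.
have Aac i j : a ^+ i * c ^+ j \in <<[set a; c]>>.
  by rewrite groupM // groupX // mem_gen ?set21 ?set22.
(* If 3 does not divide [n], then $n^2 \equiv 1$ modulo 3 and $c=(c^n)^n$ would lie in [<[a]>]. *)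
have ncX n : c ^+ n \in <[a]> -> (3 %| n)%N.
  move=> an; apply: contraR nca => n3; have := groupX n an.
  by rewrite -expgM -(modX c) // (_ : n * n %% 3 = 1)%N ?expg1 // -modnMml -modnMmr; move: n3; rewrite /dvdn; case: (n %% 3)%N (ltn_pmod n (isT : 0 < 3)%N) => [|[|[|]]].
have eI : {in dih_ok &, injective e}.
  move=> [[i j] k] [[i' j'] k']; rewrite !unfold_in /dih_ok /= => /andP[i3 j3] /andP[i'3 j'3] E.
  have Ek : k = k'.
    case: k k' E => [] [] //; rewrite /e /= mulg1 expg1.
      by move/(canRL (mulKg _))/tcom; case; rewrite groupM ?groupV.
    by move/esym/(canRL (mulKg _))/tcom; case; rewrite groupM ?groupV.
  move: E; rewrite {}Ek /e /= => /mulIg E.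
  have Ej : j = j'.
    suff : (3 %| j' + 2 * j)%N by lia.
    apply: ncX; rewrite expgD expgM.
    have -> : c ^+ j' = a ^- i' * (a ^+ i * c ^+ j) by rewrite E mulKg.
    have cc : c ^+ j * (c ^+ 2) ^+ j = 1 by rewrite -expgM -expgD -(modX c) // (_ : (_ %% 3) = 0)%N //; lia.
    by rewrite -!mulgA cc mulg1 groupM ?groupV ?mem_cycle.
  move: E; rewrite {}Ej => /mulIg/eqP; rewrite eq_expg_mod_order oa !modn_small // => /eqP->.
  by [].
pose cs := [:: (1, 0, false); (0, 0, true); (1, 0, true); (0, 1, true)]%N.
have okD : {in dih_ok &, forall u v, dih_div u v \in dih_ok}.
  by move=> [[i j] k] [[i' j'] k'] _ _; rewrite unfold_in /dih_ok /dih_div; case: k; rewrite /= !ltn_mod.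
have e0 : e (0, 0, false)%N = 1 by rewrite /e /= !mulg1.
have := @coded_mrep gT _ e dih_div dih_ok (0, 0, false)%N cs eI eD okD e0.
move/(_ isT isT isT isT isT); set W := <<_>>%G => rW.
have eW u : u \in cs -> e u \in W by move=> csu; rewrite mem_gen // inE map_f.
have [Wa Wt] : a \in W /\ t \in W.
  split; first by have := eW (1, 0, false)%N isT; rewrite /e /= !mulg1 expg1.
  by have := eW (0, 0, true)%N isT; rewrite /e /= !mul1g expg1.
have Wc : c \in W.
  have := eW (0, 1, true)%N isT; rewrite /e /= mul1g !expg1 groupMr //.
apply: (@good_supergroup _ _ W); last first.
  by rewrite gen_subG; apply/subsetP=> x; rewrite inE => /mapP[u _ ->].
apply: (small_good rW) => //; rewrite muln1.
pose us := [seq (i, j, false) | i <- iota 0 3, j <- iota 0 3] ++ [seq (i, j, true) | i <- iota 0 3, j <- iota 0 3].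
have Uus : uniq (map e us).
  rewrite map_inj_in_uniq // => u v ius ivs; apply: eI.
    by have /allP := (isT : all dih_ok us); apply.
  by have /allP := (isT : all dih_ok us); apply.
have : (size (map e us) <= #|W|)%N.
  rewrite cardE; apply: uniq_leq_size => // _ /mapP[u _ ->]; rewrite mem_enum.
  by rewrite !groupM ?groupX.
by rewrite size_map; apply: leq_trans.
Qed.

End Concrete.

(** * One layer: classification *)

Section LargeOrders.

Variables (gT : finGroupType) (G : {group gT}).
Implicit Types (a b c d x : gT) (n : nat).

Lemma sqg a : a * a = a ^+ 2.
Proof. by rewrite expgS expg1. Qed.

Lemma sq4 a : #[a] = 4 -> (a * a) ^+ 2 = 1.
Proof. by move=> oa; apply/eqP; rewrite sqg -expgM -order_dvdn oa. Qed.

Lemma good_pair n a b : a \in G -> b \in G -> (1 < n)%N ->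
    (exists S, mrep (m := 1) <<[set a; b]>>%G S n) ->
    (2 * n + 2 < #|<<[set a; b]>>|)%N ->
  good 1 G.
Proof.
move=> Ga Gb n1 [S rS] nK; apply: (@good_supergroup _ _ <<[set a; b]>>%G); last first.
  by rewrite gen_subG subUset !sub1set Ga.
by apply: (small_good rS); rewrite ?muln1.
Qed.

Lemma dvd_card_pair a b : #[a] %| #|<<[set a; b]>>|.
Proof. by rewrite order_dvdG // mem_gen ?set21. Qed.

Lemma dvd_card_pairr a b : #[b] %| #|<<[set a; b]>>|.
Proof. by rewrite order_dvdG // mem_gen ?set22. Qed.

Lemma card_pair_ge a b : b \notin <[a]> -> (2 * #[a] <= #|<<[set a; b]>>|)%N.
Proof.
move=> nab; have sK : <[a]> \subset <<[set a; b]>>%G by rewrite cycle_subG mem_gen ?set21.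
have : (1 < #|<<[set a; b]>>%G : <[a]>|)%N.
  by rewrite indexg_gt1; apply: contra nab => /subsetP; apply; rewrite mem_gen ?set22.
by move=> k1; rewrite -(Lagrange sK) mulnC leq_mul2l k1 orbT.
Qed.

(** An element [d] outside [<[a]>] with $d^2=a^2$ is replaced by $da^2$, whose square $a^6$ differs
    from $a^2$ because the order of [a] exceeds four. Then [mrep_square] applies. *)
Lemma cycle_or_good a : a \in G -> (4 < #[a])%N -> G :=: <[a]> \/ good 1 G.
Proof.
move=> Ga a4; have [sGa | /subsetPn[d Gd nad]] := boolP (G \subset <[a]>).
  by left; apply/eqP; rewrite eqEsubset sGa cycle_subG.
right; have [d' [Gd' nad' d'a]] : exists d', [/\ d' \in G, d' \notin <[a]> & d' * d' != a * a].
  have [da | ] := eqVneq (d * d) (a * a); last by exists d.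
  exists (d * (a * a)); split.
  - by rewrite !groupM.
  - by rewrite groupMr // groupM ?cycle_id.
  have cd : commute d (a * a) by rewrite -da; apply: commuteM.
  have -> : d * (a * a) * (d * (a * a)) = a * a * (a * a * (a * a)).
    by rewrite {1}cd -!(mulgA (a * a)) (mulgA d) da.
  rewrite -[X in _ == X]mulg1 (inj_eq (mulgI _)).
  apply: contraTneq a4 => a41; rewrite -leqNgt dvdn_leq // order_dvdn.
  by rewrite !expgS expg0 mulg1 mulgA a41.
apply: (good_pair (n := 3) Ga Gd') => //; first by apply: mrep_square => //; apply: ltnW.
by apply: leq_trans (card_pair_ge nad'); lia.
Qed.

Lemma good_involution a b : a \in G -> b \in G -> (3 < #[a])%N -> #[b] = 2%N ->
  b \notin <[a]> -> good 1 G.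
Proof.
move=> Ga Gb a3 ob nab; apply: (good_pair (n := 2) Ga Gb) => //.
  by apply: mrep_involution => //; apply: ltnW.
by apply: leq_trans (card_pair_ge nab); lia.
Qed.

Lemma cycle4P a x : #[a] = 4 -> x \in <[a]> -> [\/ x = 1, x = a, x = a * a | x = a^-1].
Proof.
move=> oa /cyclePmin[i]; rewrite oa; case: i => [|[|[|[|]]]] // _ ->.
- by constructor 1.
- by constructor 2; rewrite expg1.
- by constructor 3; rewrite expgS expg1.
by constructor 4; apply/eqP; rewrite eq_sym eq_invg_mul -expgS -order_dvdn oa.
Qed.

(** [<[a]>] has index two, hence is normal, and its only elements of order four are [a] and its
    inverse. *)
Lemma conj_index2 a d : #[a] = 4 -> #|<<[set a; d]>>| = 8 -> a ^ d != a -> a ^ d = a^-1.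
Proof.
move=> oa oK ad; pose K := <<[set a; d]>>%G.
have sK : <[a]> \subset K by rewrite cycle_subG mem_gen ?set21.
have iK : #|K : <[a]>| = 2.
  by apply/eqP; rewrite -(eqn_pmul2l (cardG_gt0 <[a]>)) Lagrange // -orderE oa oK.
have nK := index2_normal sK iK.
have : a ^ d \in <[a]>.
  by rewrite memJ_norm ?cycle_id // (subsetP (normal_norm nK)) // mem_gen ?set22.
have := orderJ a d; rewrite oa => + /(cycle4P oa)[] // e; rewrite e.
- by rewrite order1.
- by case/eqP: ad.
by move=> o4; have := order_dvdn (a * a) 2; rewrite o4 sq4 ?eqxx.
Qed.

Lemma order4_sq a d : #[a] = 4 -> d * d = a * a -> #[d] = 4.
Proof.
move=> oa dd.
have : #[d] %| 4 by rewrite order_dvdn (expgM d 2 2) -!sqg dd (sqg (a * a)) sq4.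
have : ~~ (#[d] %| 2) by rewrite order_dvdn -sqg dd sqg -order_dvdn oa.
by case: #[d] => [|[|[|[|[|k]]]]] // _ /dvdn_leq; move=> /(_ isT).
Qed.

Hypothesis ord4 : {in G, forall x, #[x] <= 4}%N.

(** If the squares differ, the order of [d] decides: 2 gives an involution outside [<[a]>], 3 gives
    a group of order at least 12 for [mrep_square], and 4 makes $d^2$ an involution outside [<[a]>].
    If they agree and [a], [d] commute, $ad^{-1}$ is such an involution. Otherwise
    [mrep_noncommuting] applies unless the quaternion relations hold. *)
Lemma order4_pair a d : a \in G -> d \in G -> #[a] = 4 -> d \notin <[a]> ->
  good 1 G \/ [/\ d * d = a * a, a ^ d = a^-1 & d ^ a = d^-1].
Proof.
move=> Ga Gd oa nad.
have a3 : (3 < #[a])%N by rewrite oa.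
have d1 : (1 < #[d])%N by rewrite order_gt1; apply: contraNneq nad => ->.
have aa4 : a * a * (a * a) = 1 by rewrite (sqg (a * a)) sq4.
have [dd | ndd] := eqVneq (d * d) (a * a); last first.
  left; have : #[d] \in [:: 2; 3; 4] by have := ord4 Gd; rewrite !inE; lia.
  rewrite !inE => /or3P[]/eqP od.
  - exact: good_involution nad.
  - apply: (good_pair (n := 3) Ga Gd) => //; first exact: mrep_square.
    have := dvd_card_pair a d; have := dvd_card_pairr a d; rewrite oa od.
    have : (0 < #|<<[set a; d]>>|)%N by apply: cardG_gt0.
    by move: #|_|; lia.
  have dd1 : d * d != 1.
    by rewrite sqg -order_dvdn od.
  have odd : #[d * d] = 2.
    apply: nt_prime_order => //; exact: sq4.
  apply: (good_involution (a := a) (b := d * d)) => //; first by rewrite groupM.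
  apply/negP=> /(cycle4P oa) [] e.
  - by rewrite e eqxx in dd1.
  - by move: odd; rewrite e oa.
  - by rewrite e eqxx in ndd.
  by move: odd; rewrite e orderV oa.
have od := order4_sq oa dd.
have [cad | ncad] := eqVneq (a * d) (d * a).
  left; apply: (good_involution Ga (b := a * d^-1)) => //.
  - by rewrite groupM ?groupV.
  - apply: nt_prime_order => //.
      have cadV : commute a d^-1 by apply/commuteV.
      by rewrite expgMn // expgVn -!sqg dd mulgV.
    by rewrite -eq_mulgV1; apply: contraNneq nad => <-; rewrite cycle_id.
  by rewrite (groupMl _ (cycle_id a)) groupV.
have [/andP[/eqP ad /eqP da] | nQ] := boolP ((a ^ d == a^-1) && (d ^ a == d^-1)).
  by right.
left; apply: (good_pair (n := 3) Ga Gd) => //.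
  by apply: mrep_noncommuting; rewrite ?oa ?od.
have K4 := dvd_card_pair a d; have := card_pair_ge nad; rewrite oa in K4 *.
(* Valency three needs more than eight vertices. Order eight would make both cyclic subgroups of
   index two and force the excluded relations. *)
suff : #|<<[set a; d]>>| != 8 by lia.
apply: contra nQ => /eqP oK; apply/andP; split; apply/eqP.
  apply: conj_index2 => //; apply: contra ncad => /eqP ad.
  by rewrite conjgC ad.
apply: conj_index2; rewrite // 1?setUC //; apply: contra ncad => /eqP da.
by rewrite eq_sym conjgC da.
Qed.

End LargeOrders.

(** * Quaternion groups and groups with elements of order at most three *)

Section SmallOrders.

Variables (gT : finGroupType) (G : {group gT}).
Implicit Types (a b c d x : gT) (n : nat).

(** The relations present the subgroup as an image of ['Q_8], and it has at least eight elements. *)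
Lemma quaternion_isog a d : #[a] = 4 -> d \notin <[a]> -> d * d = a * a -> a ^ d = a^-1 ->
  <<[set a; d]>> \isog 'Q_8.
Proof.
move=> oa nad dd ad; rewrite isogEcard.
have -> : #|'Q_8| = 8 by rewrite (@card_quaternion 3).
apply/andP; split; last by have := card_pair_ge nad; rewrite oa.
rewrite (@Grp_quaternion 3 isT _ <<[set a; d]>>%G).
apply/existsP; exists (a, d); rewrite /= !xpair_eqE ad -!sqg dd !eqxx andbT /=.
by rewrite joing_idl joing_idr -order_dvdn oa eqxx.
Qed.

(** An element [x] outside the quaternion subgroup would, unless [G] is good, invert [a], [d] and
    [a * d]. Then $a^{-1}d^{-1}=(ad)^{-1}$, so [a] and [d] would commute, contrary to
    $a^d=a^{-1}$. *)
Lemma order4_case a : {in G, forall x, #[x] <= 4}%N -> a \in G -> #[a] = 4 ->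
  [\/ G :=: <[a]>, G \isog 'Q_8 | good 1 G].
Proof.
move=> ord4 Ga oa; have [sGa | /subsetPn[d Gd nad]] := boolP (G \subset <[a]>).
  by constructor 1; apply/eqP; rewrite eqEsubset sGa cycle_subG.
have [gG | [dd ad da]] := order4_pair ord4 Ga Gd oa nad; first by constructor 3.
have sKG : <<[set a; d]>> \subset G by rewrite gen_subG subUset !sub1set Ga.
have [sGK | /subsetPn[x Gx nKx]] := boolP (G \subset <<[set a; d]>>).
  constructor 2; have -> : G :=: <<[set a; d]>> by apply/eqP; rewrite eqEsubset sGK.
  exact: quaternion_isog.
have Ka : a \in <<[set a; d]>> by rewrite mem_gen ?set21.
have Kd : d \in <<[set a; d]>> by rewrite mem_gen ?set22.
have ncyc y : y \in <<[set a; d]>> -> x \notin <[y]>.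
  by move=> Ky; apply: contra nKx; apply: subsetP; rewrite cycle_subG.
constructor 3.
have [//|[_ ax _]] := order4_pair ord4 Ga Gx oa (ncyc _ Ka).
have [//|[_ dx _]] := order4_pair ord4 Gd Gx (order4_sq oa dd) (ncyc _ Kd).
have nad' : a * d \notin <[a]> by rewrite (groupMl _ (cycle_id a)).
have [//|[adad _ _]] := order4_pair ord4 Ga (groupM Ga Gd) oa nad'.
have [//|[_ adx _]] := order4_pair ord4 (groupM Ga Gd) Gx (order4_sq oa adad) (ncyc _ (groupM Ka Kd)).
move: adx; rewrite conjMg ax dx invMg => /(congr1 invg); rewrite !invMg !invgK => cda.
have := ad; rewrite conjgE -cda mulKg => /esym/eqP.
by rewrite eq_invg_mul sqg -order_dvdn oa.
Qed.

Hypothesis ord3 : {in G, forall x, #[x] <= 3}%N.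

(** Inversion of [a] by [c] would give $a=a^{c^3}=a^{-1}$, so [mrep_noncommuting] applies; the
    product of the two cyclic groups already has nine elements. *)
Lemma order3_commute a c : a \in G -> c \in G -> #[a] = 3 -> #[c] = 3 ->
  good 1 G \/ commute a c.
Proof.
move=> Ga Gc oa oc; have [cac | ncac] := eqVneq (a * c) (c * a); first by right.
left; apply: (good_pair (n := 3) Ga Gc) => //.
  apply: mrep_noncommuting; rewrite ?oa ?oc //; apply/negP=> /andP[/eqP ac _].
  have := conjg1 a; rewrite -(expg_order c) oc !expgS expg0 mulg1 !conjgM !(ac, conjVg) invgK.
  by move/eqP; rewrite eq_invg_mul sqg -order_dvdn oa.
have TI : <[a]> :&: <[c]> = 1.
  apply: prime_TIg; first by rewrite -orderE oa.
  by rewrite cycle_subG; apply: contra ncac => /cycleP[i ->]; rewrite -expgS -expgSr.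
apply: leq_trans (subset_leq_card (_ : <[a]> * <[c]> \subset _)).
  by rewrite TI_cardMg // -!orderE oa oc.
by rewrite mul_subG // cycle_subG mem_gen ?set21 ?set22.
Qed.

(** More than six elements suffice for the pair of [a] and [b]. In a group of order six [<[a]>] is
    normal, and commuting generators would have a product of order six. *)
Lemma order3_invert a b : a \in G -> b \in G -> #[a] = 3 -> #[b] = 2 ->
  good 1 G \/ a ^ b = a^-1.
Proof.
move=> Ga Gb oa ob; case: (ltnP 6 #|<<[set a; b]>>|) => [K7 | K6].
  by left; apply: (good_pair (n := 2) Ga Gb) => //; apply: mrep_involution; rewrite ?oa.
right; pose K := <<[set a; b]>>%G.
have sK : <[a]> \subset K by rewrite cycle_subG mem_gen ?set21.
have oK : #|K| = 6.
  have : (0 < #|<<[set a; b]>>|)%N by apply: cardG_gt0.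
  have := dvd_card_pair a b; have := dvd_card_pairr a b; rewrite oa ob.
  by move: K6; rewrite /K /=; move: #|_|; lia.
have iK : #|K : <[a]>| = 2.
  by apply/eqP; rewrite -(eqn_pmul2l (cardG_gt0 <[a]>)) Lagrange // -orderE oa oK.
have nK := index2_normal sK iK.
have : a ^ b \in <[a]>.
  by rewrite memJ_norm ?cycle_id // (subsetP (normal_norm nK)) // mem_gen ?set22.
have a1 : a != 1 by rewrite -order_gt1 oa.
have b1 : b != 1 by rewrite -order_gt1 ob.
have aa1 : a * a != 1 by rewrite sqg -order_dvdn oa.
have a3 : a ^+ 3 = 1 by rewrite -oa expg_order.
have b2 : b ^+ 2 = 1 by rewrite -ob expg_order.
case/cyclePmin=> i; rewrite oa; case: i => [|[|[|]]] // _ e.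
- by case/eqP: a1; apply: (conjg_inj b); rewrite e conj1g.
- have cab : commute a b by rewrite /commute conjgC e expg1.
  have : #[a * b] \in [:: 1; 2; 3]%N.
    by have := ord3 (groupM Ga Gb); have := order_gt0 (a * b); rewrite !inE; lia.
  rewrite !inE => /or3P[]/eqP o; have := expg_order (a * b); rewrite o expgMn //.
  + move/eqP; rewrite !expg1 -eq_invg_mul => /eqP ba.
    by have := orderV a; rewrite ba oa ob.
  + by rewrite b2 mulg1 -sqg => /eqP; rewrite (negPf aa1).
  by rewrite a3 mul1g expgS b2 mulg1 => /eqP; rewrite (negPf b1).
by rewrite e; apply/eqP; rewrite eq_sym eq_invg_mul -expgS a3.
Qed.

(** When orders 2 and 3 both occur and [x] lies outside [<<[set a; b]>>], an element [c] of order
    three outside [<[a]>] is sought for the generalized dihedral case. If [x] is an involution, it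
    inverts [a] like [b], so [b * x] centralizes [a]; it cannot be an involution and serves as
    [c]. *)
Lemma order3_case : [\/ good 1 G, 2.-abelem G, 3.-abelem G |
  exists a b, [/\ #[a] = 3, #[b] = 2 & G = <<[set a; b]>>%G]].
Proof.
have ordE x : x \in G -> #[x] \in [:: 1; 2; 3]%N.
  by move=> Gx; have := ord3 Gx; have := order_gt0 x; rewrite !inE; lia.
case: (boolP [exists a in G, #[a] == 3]) => [/exists_inP[a Ga /eqP oa] | no3]; last first.
  constructor 2; apply/exponent2_abelem/exponentP=> x Gx; apply/eqP; rewrite -order_dvdn.
  have := ordE _ Gx; rewrite !inE => /or3P[]/eqP o; rewrite ?o //.
  by case/exists_inP: no3; exists x => //; apply/eqP.
case: (boolP [exists b in G, #[b] == 2]) => [/exists_inP[b Gb /eqP ob] | no2]; last first.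
  have o3 x : x \in G -> x != 1 -> #[x] = 3.
    move=> Gx; rewrite -order_eq1; have := ordE _ Gx; rewrite !inE => /or3P[]/eqP o; rewrite ?o //.
    by case/exists_inP: no2; exists x => //; apply/eqP.
  case: (boolP [forall x in G, forall y in G, x * y == y * x]) => [/forall_inP abG | ].
    constructor 3; apply/abelemP=> //; split=> [|x Gx].
      by apply/centsP=> x Gx y Gy; apply/eqP/(forall_inP (abG x Gx)).
    have [-> | x1] := eqVneq x 1; first exact: expg1n.
    by rewrite -(o3 x Gx x1) expg_order.
  rewrite negb_forall_in => /exists_inP[x Gx]; rewrite negb_forall_in => /exists_inP[y Gy nxy].
  constructor 1; have [||//|cxy] := order3_commute Gx Gy.
  - by apply: o3 => //; apply: contraNneq nxy => ->; rewrite mul1g mulg1.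
  - by apply: o3 => //; apply: contraNneq nxy => ->; rewrite mul1g mulg1.
  by case/eqP: nxy.
have [//|ab] := order3_invert Ga Gb oa ob; first by constructor 1.
have sKG : <<[set a; b]>> \subset G by rewrite gen_subG subUset !sub1set Ga.
case: (boolP (G \subset <<[set a; b]>>)) => [sGK | /subsetPn[x Gx nKx]].
  by constructor 4; exists a, b; split=> //; apply/val_inj/eqP; rewrite eqEsubset sGK.
constructor 1.
have Ka : a \in <<[set a; b]>> by rewrite mem_gen ?set21.
have Kb : b \in <<[set a; b]>> by rewrite mem_gen ?set22.
have sKa : <[a]> \subset <<[set a; b]>> by rewrite cycle_subG.
suff [gG | [c [Gc oc nac]]] : good 1 G \/ exists c, [/\ c \in G, #[c] = 3 & c \notin <[a]>] => //.
  have [//|cac] := order3_commute Ga Gc oa oc.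
  have [//|cb] := order3_invert Gc Gb oc ob.
  by apply: (@good_generalized_dihedral _ a c b) => //; rewrite sqg -ob expg_order.
have := ordE _ Gx; rewrite !inE => /or3P[]/eqP ox.
- by case/negP: nKx; move/eqP: ox; rewrite order_eq1 => /eqP->; apply: group1.
- have [gG|ax] := order3_invert Ga Gx oa ox; first by left.
  have nbx : b * x \notin <<[set a; b]>> by rewrite groupMl.
  have := ordE _ (groupM Gb Gx); rewrite !inE => /or3P[]/eqP obx.
  + by case/negP: nbx; move/eqP: obx; rewrite order_eq1 => /eqP->; apply: group1.
  + have [gG|] := order3_invert Ga (groupM Gb Gx) oa obx; first by left.
    rewrite conjgM ab conjVg ax invgK => /esym/eqP.
    by rewrite eq_invg_mul sqg -order_dvdn oa.
  right; exists (b * x); split=> //; first by rewrite groupM.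
  by apply: contra nbx; apply: subsetP.
by right; exists x; split=> //; apply: contra nKx; apply: subsetP.
Qed.

End SmallOrders.

(** * Assembly of the classification *)

Lemma Zp_elem_abelem (H : finGroupType) p : prime p ->
  (forall x y : H, x * y = y * x) -> (forall x : H, x ^+ p = 1) -> p.-abelem [set: H].
Proof.
move=> pr HC Hp; apply/abelemP=> //; split=> //.
by apply/centsP=> x _ y _; apply: HC.
Qed.

Lemma pair_expg (H K : finGroupType) (x : H) (y : K) n :
  ((x, y) : (H * K)%type) ^+ n = (x ^+ n, y ^+ n).
Proof. by elim: n => [|n IHn]; rewrite ?expg0 // !expgS IHn. Qed.

Lemma mDRR_cyclic1 (gT : finGroupType) (G : {group gT}) a : G :=: <[a]> -> has_mDRR G 1.
Proof.
move=> defG; have {defG}-> : G = <[a]>%G by apply/val_inj.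
have [-> | /mrep_cycle[S rS]] := eqVneq a 1; last exact: (mDRR_of_mrep _ rS).
have [S rS] := mrep1 gT; apply: (mDRR_of_mrep (S := S) (d := 0)) => //.
by rewrite (_ : <[1]>%G = 1%G) //; apply/val_inj; rewrite /= cycle1.
Qed.

Lemma mDRR_one (gT : finGroupType) (G : {group gT}) :
  has_mDRR G 1 \/
  [\/ G \isog 'Q_8,
      G \isog [set: 'Z_2 * 'Z_2],
      G \isog [set: 'Z_2 * 'Z_2 * 'Z_2]
    | (G \isog [set: 'Z_2 * 'Z_2 * 'Z_2 * 'Z_2] \/ G \isog [set: 'Z_3 * 'Z_3])].
Proof.
have goodG : good 1 G -> has_mDRR G 1 by apply: good_mDRR.
case: (boolP [exists a in G, (4 < #[a])%N]) => [/exists_inP[a Ga a4] | /exists_inPn ord4].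
  by left; have [/mDRR_cyclic1|] := cycle_or_good Ga a4; last exact: goodG.
have {}ord4 : {in G, forall x, #[x] <= 4}%N by move=> x /ord4; rewrite -leqNgt.
case: (boolP [exists a in G, #[a] == 4]) => [/exists_inP[a Ga /eqP oa] | /exists_inPn no4].
  have [/mDRR_cyclic1||/goodG] := order4_case ord4 Ga oa; try by left.
  by right; constructor 1.
have ord3 : {in G, forall x, #[x] <= 3}%N.
  by move=> x Gx; have := ord4 x Gx; rewrite leq_eqVlt (negPf (no4 x Gx)).
have z2 (x : 'Z_2) : x ^+ 2 = 1 by case: x => -[|[|]] // ?; apply/val_inj.
have z3 (x : 'Z_3) : x ^+ 3 = 1 by case: x => -[|[|[|]]] // ?; apply/val_inj.
have zC n (x y : 'Z_n) : x * y = y * x by apply: GRing.addrC.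
case: (order3_case ord3) => [/goodG | abG | abG | [a [b [oa ob ->]]]]; first by left.
- have oG := card_pgroup (abelem_pgroup abG).
  (* Ranks from five on contain a subgroup of order 32, which is good; the smaller ranks are treated
     one by one. *)
  have := normal_pgroup (r := 5) (abelem_pgroup abG) (normal_refl G).
  case: (logn 2 #|G|) oG => [|[|[|[|[|k]]]]] oG nG.
  + by left; apply: (@mDRR_cyclic1 _ _ 1); rewrite cycle1; apply/card1_trivg.
  + left; have /cyclicP[a] : cyclic G by apply: prime_cyclic; rewrite oG.
    exact: mDRR_cyclic1.
  + right; constructor 2; rewrite (isog_abelem_card _ abG) oG cardsT !card_prod !card_ord andbT.
    by apply: Zp_elem_abelem => // [[? ?] [? ?]|[? ?]]; rewrite ?pair_expg ?z2 //; congr (_, _); apply: zC.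
  + right; constructor 3; rewrite (isog_abelem_card _ abG) oG cardsT !card_prod !card_ord andbT.
    by apply: Zp_elem_abelem => // [[[? ?] ?] [[? ?] ?]|[[? ?] ?]]; rewrite ?pair_expg ?z2 //; congr (_, _, _); apply: zC.
  + right; constructor 4; left; rewrite (isog_abelem_card _ abG) oG cardsT !card_prod !card_ord andbT.
    by apply: Zp_elem_abelem => // [[[[? ?] ?] ?] [[[? ?] ?] ?]|[[[? ?] ?] ?]]; rewrite ?pair_expg ?z2 //; congr (_, _, _, _); apply: zC.
  have [//|E [sEG _ oE]] := nG; left; apply/goodG/(good_supergroup _ sEG).
  by apply: good_Z2_5; rewrite ?oE // (abelemS sEG).
- have oG := card_pgroup (abelem_pgroup abG).
  have := normal_pgroup (r := 3) (abelem_pgroup abG) (normal_refl G).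
  case: (logn 3 #|G|) oG => [|[|[|k]]] oG nG.
  + by left; apply: (@mDRR_cyclic1 _ _ 1); rewrite cycle1; apply/card1_trivg.
  + left; have /cyclicP[a] : cyclic G by apply: prime_cyclic; rewrite oG.
    exact: mDRR_cyclic1.
  + right; constructor 4; right; rewrite (isog_abelem_card _ abG) oG cardsT !card_prod !card_ord andbT.
    by apply: Zp_elem_abelem => // [[? ?] [? ?]|[? ?]]; rewrite ?pair_expg ?z3 //; congr (_, _); apply: zC.
  have [//|E [sEG _ oE]] := nG; left; apply/goodG/(good_supergroup _ sEG).
  by apply: good_Z3_3; rewrite ?oE // (abelemS sEG).
(* Here the generators yield a representation of the whole group, so no density is required. *)
have [|S rS] := mrep_involution _ ob (a := a); first by rewrite oa.
by left; apply: (mDRR_of_mrep _ rS).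
Qed.

Theorem theorem1p2 (m : nat) (gT : finGroupType) (G : {group gT}) :
  (0 < m)%N ->
  [\/ has_mDRR G m,
      m = 1%N /\
        [\/ G \isog 'Q_8,
            G \isog [set: 'Z_2 * 'Z_2],
            G \isog [set: 'Z_2 * 'Z_2 * 'Z_2]
          | (G \isog [set: 'Z_2 * 'Z_2 * 'Z_2 * 'Z_2]
             \/ G \isog [set: 'Z_3 * 'Z_3])],
      m = 2%N /\ (G \isog [set: 'I_1] \/ G \isog [set: 'Z_2])
    | (3 <= m <= 5)%N /\ G \isog [set: 'I_1]].
Proof.
move=> m0; case: (ltngtP m 1) => [|m1|->]; first by lia.
  have I1 : #|G| = 1%N -> G \isog [set: 'I_1].
    move=> oG; rewrite isog_cyclic_card ?cardsT ?card_ord ?oG ?eqxx ?andbT.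
      by apply: (eq_ind_r cyclic (cyclic1 _)); apply/card1_trivg; rewrite cardsT card_ord.
    by rewrite (card1_trivg oG) cyclic1.
  case: (ltngtP #|G| 1) => [|G1|oG]; first by rewrite ltnNge cardG_gt0.
    have [[m2 oG] | big] : (m = 2 /\ #|G| = 2) \/ (m = 2 -> 2 < #|G|)%N by lia.
      have cG : cyclic G by rewrite prime_cyclic ?oG.
      constructor 3; split=> //; right.
      have o2 : #|[set: 'Z_2]| = 2 by rewrite cardsT card_ord.
      by rewrite (isog_cyclic_card _ cG) o2 oG prime_cyclic ?o2.
    by constructor 1; apply: mDRR_multilayer.
  case: (ltnP m 6) => m6; last first.
    constructor 1; rewrite -(subnKC m6) !addSn add0n.
    exact: (mDRR_of_mrep _ (asym_mrep _ oG)).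
  have [-> | m2] := eqVneq m 2; first by constructor 3; split=> //; left; apply: I1.
  by constructor 4; split; [lia | apply: I1].
by case: (mDRR_one G) => [|?]; [constructor 1 | constructor 2].
Qed.
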